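(* Let $F=(\phi,\psi):\mathbb{D}^2\to\mathbb{D}^2$ be holomorphic, with $\phi$ a left Type I function and $\psi$ a right Type I function. Let $\tau^1\in\mathbb{T}$ and $\tau^2\in\mathbb{T}$ denote the common Denjoy-Wolff points of all slice functions $\phi(\cdot,\mu)$, $\mu\in\mathbb{D}$, and $\psi(\lambda,\cdot)$, $\lambda\in\mathbb{D}$, respectively. If $\tau=(\tau^1,\tau^2)$ is not a C-point for $\phi$, then every cluster point of $\{F^n\}$ has the form $(\tau^1,h)$, where $h$ is either a holomorphic function $\mathbb{D}^2\to\mathbb{D}$ or the constant $\tau^2$. Analogously, if $\tau$ is not a C-point for $\psi$, then every cluster point of $\{F^n\}$ has the form $(g,\tau^2)$, where $g$ is either a holomorphic function $\mathbb{D}^2\to\mathbb{D}$ or the constant $\tau^1$.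
   Context: Notation. $\mathbb{D}$ is the open unit disk, $\mathbb{T}=\partial\mathbb{D}$. Superscripts $1,2$ on points are coordinate indices: $\lambda=(\lambda^1,\lambda^2)$. $\|(\lambda^1,\lambda^2)\|=\max\{|\lambda^1|,|\lambda^2|\}$. $\pi^i(\lambda)=\lambda^i$ are the coordinate projections on $\mathbb{D}^2$. $F^n=F\circ\cdots\circ F$ ($n$ times); a cluster point of $\{F^n\}$ is a limit of a subsequence, uniformly on compact subsets of $\mathbb{D}^2$. A holomorphic $\phi:\mathbb{D}^2\to\mathbb{D}$ is a left Type I function if $\phi\ne\pi^1$ and there is $\tau^1\in\mathbb{T}$ that is the Denjoy-Wolff point of $\phi(\cdot,\mu):\mathbb{D}\to\mathbb{D}$ for every $\mu\in\mathbb{D}$; $\psi$ is a right Type I function if $\widetilde\psi(\lambda^1,\lambda^2)=\psi(\lambda^2,\lambda^1)$ is a left Type I function. (For a holomorphic $f:\mathbb{D}\to\mathbb{D}$ without fixed points, its Denjoy-Wolff point is the point of $\mathbb{T}$ to which the iterates of $f$ converge.) A set $S\subset\mathbb{D}^2$ approaches $\tau\in\partial\mathbb{D}^2$ nontangentially if $\tau$ is in the closure of $S$ and there is $c>0$ with $\|\tau-\lambda\|\le c(1-\|\lambda\|)$ for all $\lambda\in S$. $\tau\in\partial\mathbb{D}^2$ is a B-point for $\phi$ if $\liminf_{\lambda\to\tau}\frac{1-|\phi(\lambda)|}{1-\|\lambda\|}<\infty$; then the nontangential limit of $\phi$ at $\tau$ exists and is denoted $\phi(\tau)$. A B-point $\tau$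 is a C-point for $\phi$ if $\phi$ has an angular gradient at $\tau$, i.e. there is $\eta\in\mathbb{C}^2$ with $\phi(\lambda)=\phi(\tau)+\eta^1(\lambda^1-\tau^1)+\eta^2(\lambda^2-\tau^2)+o(\|\lambda-\tau\|)$ as $\lambda\to\tau$ nontangentially. *)

(* Defs.v *)
From HB Require Import structures.
From mathcomp Require Export all_boot all_order all_algebra.
From mathcomp Require Export complex.
From mathcomp Require Export all_classical all_reals all_analysis.
Export numFieldNormedType.Exports.

Set Implicit Arguments.
Unset Strict Implicit.
Unset Printing Implicit Defensive.

Import Order.TTheory GRing.Theory Num.Theory.

Local Open Scope classical_set_scope.
Local Open Scope ring_scope.

(* The topology of [R[i]] is found by the library on the copy [R[i]^o]. The
   library norm of [R[i]^o * R[i]^o] is the maximum of the two moduli. Norms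
   take their values in [R[i]], whose (partial) order relates only numbers
   with the same imaginary part. *)
Notation Cplx R := (R[i]^o)%type.

Section Definitions.
Variable R : realType.
Local Notation C := (Cplx R).
Local Notation C2 := (C * C)%type.
Implicit Types (f : C -> C) (phi : C2 -> C) (F G : C2 -> C2).
Implicit Types (S : set C2).

Definition disk : set C := [set z | `|z| < 1].

Definition circle : set C := [set z | `|z| = 1].

Definition bidisk : set C2 := disk `*` disk.

Definition bidisk_boundary : set C2 := closure bidisk `\` bidisk°.

(* Maps are total functions, of which only the values on the domain [D]
   matter; the domains below are open, so that differentiability at a point
   of [D] is not affected by values outside [D]. *)
Definition holomorphic_map (V W : normedModType R[i]) (D : set V) (E : set W)
    (f : V -> W) : Prop :=
  (forall z, D z -> differentiable f z) /\ (forall z, D z -> E (f z)).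

Definition cvg_on_compacts (V W : normedModType R[i]) (D : set V)
    (u : nat -> V -> W) (g : V -> W) : Prop :=
  {family [set K | compact K /\ K `<=` D], u @ \oo --> g}.

Definition Denjoy_Wolff_point f (tau : C) : Prop :=
  [/\ holomorphic_map disk disk f,
      forall z, disk z -> f z <> z,
      circle tau
    & cvg_on_compacts disk (fun n => iter n f) (fun=> tau)].

Definition left_type_I phi : Prop :=
  [/\ holomorphic_map bidisk disk phi,
      ~ (forall l, bidisk l -> phi l = l.1)
    & exists2 tau1 : C, circle tau1 &
        forall mu, disk mu -> Denjoy_Wolff_point (fun z => phi (z, mu)) tau1].

Definition right_type_I phi : Prop := left_type_I (fun l => phi (l.2, l.1)).

Definition approaches_nontangentially S (tau : C2) : Prop :=
  [/\ S `<=` bidisk, closure S tau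
    & exists2 c : R, 0 < c &
        forall l, S l -> `|tau - l| <= c%:C%C * (1 - `|l|)].

(* The quotient is a real number of [R[i]], identified with its real part. *)
Definition B_point phi (tau : C2) : Prop :=
  bidisk_boundary tau /\
  (limf_einf (fun l => (complex.Re ((1 - `|phi l|) / (1 - `|l|)))%:E)
     (within bidisk (nbhs tau)) < +oo)%E.

Definition nontangential_limit phi (tau : C2) (w : C) : Prop :=
  forall S, approaches_nontangentially S tau ->
    phi l @[l --> within S (nbhs tau)] --> w.

Definition angular_gradient phi (tau : C2) (w : C) (eta : C2) : Prop :=
  forall S, approaches_nontangentially S tau ->
    forall l : C2, phi l = w + (eta.1 * (l.1 - tau.1) + eta.2 * (l.2 - tau.2))
      +o_(l \near within S (nbhs tau)) (l - tau).

Definition C_point phi (tau : C2) : Prop :=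
  B_point phi tau /\
  exists2 w, nontangential_limit phi tau w &
    exists eta, angular_gradient phi tau w eta.

Definition iterates_cluster_point F G : Prop :=
  exists2 k : nat -> nat, {homo k : m n / (m < n)%N} &
    cvg_on_compacts bidisk (fun j => iter (k j) F) G.

End Definitions.

Arguments disk {R}.
Arguments circle {R}.
Arguments bidisk {R}.

(* Main.v *)
Require Import Defs.
From HB Require Import structures.
From mathcomp Require Import ring lra.

(** Normalise by the half-plane coordinates [cayley t z = (t + z) / (t - z)],
    where [t] is the relevant coordinate of [tau = (tau1, tau2)]; the real part of
    [cayley t z] is [horo t z], and [z] tends to [t] when [horo t z] tends to
    infinity. Since [tau1] is the Denjoy-Wolff point of all slices of [phi],
    Wolff's lemma (lemma [wolff]) says that the real part of
    [drift = cayley tau1 (phi l) - cayley tau1 l.1] is nonnegative on the bidisk,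
    so [horo] of the first coordinate never decreases along an orbit of [F]; the
    same holds for the second coordinate and [psi].

    The theorem rests on a dichotomy. Either the real part of the drift is at
    least [c * min (horo tau1 l.1) (horo tau2 l.2)] for some positive [c]. This
    minimum does not decrease along orbits, so [horo] of the first coordinate
    gains at least a fixed positive amount at each step, and the first coordinate
    tends to [tau1] (lemma [iter_escapes]). Or this fails for every [c]; then
    Harnack's inequality on the bidisk ([harnack_bidisk]), used from base points
    at which the drift is relatively small, shows that the drift is [o] of the
    inverse distance to [tau] in nontangential regions ([drift_small]). Undoing
    the Cayley transforms, [phi l - l.1] is [o] of that distance
    ([displacement_small]), so [tau] is a C-point of [phi] with angular gradient
    [(1, 0)] ([C_point_of_small_drift]); that [tau] is a B-point follows from
    Wolff's lemma along the radius. Hence, when [tau] is not a C-point of [phi],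
    every cluster point has first coordinate [tau1].

    The other coordinate [h] of a cluster point is a pointwise limit of
    holomorphic functions with values in the disk, hence holomorphic
    ([holomorphic_limit]). If its modulus is one at some point, Harnack's
    inequality for [1 - cnj c * h] makes [h] constant, and the monotonicity of
    [horo] only allows the value [tau2] ([cluster_coordinate]).

    The complex analysis behind this is developed from complex differentiability
    alone. Goursat's theorem on rectangles gives Cauchy's formula on squares,
    with an unspecified period. Cauchy's formula at the centre bounds a value by
    a constant times the maximum over the boundary; passing to powers of the
    function removes the constant, and multiplying the four rotations of the
    function about the centre turns the bound into a maximum principle. The
    Schwarz lemma follows, then Schwarz-Pick and Harnack. A second order
    expansion of the kernel in Cauchy's formula yields Taylor estimates that are
    uniform over bounded functions, which is what limits of holomorphic functions
    require. *)

Set Implicit Arguments.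
Unset Strict Implicit.
Unset Printing Implicit Defensive.

Import Order.TTheory GRing.Theory Num.Theory.

Local Open Scope classical_set_scope.
Local Open Scope ring_scope.

(** * Real-valued norms *)

(** Norms over [R[i]] lie in the partially ordered [R[i]]; their real parts
    carry the same information and live in an ordered field. The definition is
    locked so that arithmetic tactics treat norms as atoms. *)
HB.lock Definition rnorm (R : realType) (V : normedModType R[i]) (v : V) : R :=
  complex.Re `|v|.

(** The copies [re], [im], ... of the library functions are typed on [R[i]^o],
    so that every operation below is that of one structure. *)
Definition re (R : realType) (z : Cplx R) : R := complex.Re z.
Definition im (R : realType) (z : Cplx R) : R := complex.Im z.
Definition rc (R : realType) (x : R) : Cplx R := x%:C%C.
Definition cnj (R : realType) (z : Cplx R) : Cplx R := (z^*)%C.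
Definition ci (R : realType) : Cplx R := 'i%C.

Section RealNorm.
Variable R : realType.
Local Notation C := (Cplx R).

Section Generic.
Variable V : normedModType R[i].
Implicit Types u v : V.

Lemma normE v : `|v| = (rnorm v)%:C%C :> R[i].
Proof.
have := normr_ge0 v; rewrite rnorm.unlock; case: `|v| => a b /=.
by rewrite lecE /= => /andP[/eqP -> _].
Qed.

Lemma rnorm_ge0 v : 0 <= rnorm v.
Proof. by have := normr_ge0 v; rewrite normE ler0c. Qed.

Lemma rnormD u v : rnorm (u + v) <= rnorm u + rnorm v.
Proof. by have := ler_normD u v; rewrite !normE -rmorphD lecR. Qed.

Lemma rnormN v : rnorm (- v) = rnorm v.
Proof. by rewrite rnorm.unlock normrN. Qed.

Lemma rnormB u v : rnorm (u - v) <= rnorm u + rnorm v.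
Proof. by rewrite -(rnormN v) rnormD. Qed.

Lemma rnorm_sub u v : rnorm (u - v) = rnorm (v - u).
Proof. by rewrite -rnormN opprB. Qed.

Lemma rnorm0 : rnorm (0 : V) = 0.
Proof. by rewrite rnorm.unlock normr0. Qed.

Lemma rnorm_eq0 v : rnorm v = 0 -> v = 0.
Proof. by move=> h; apply/normr0_eq0; rewrite normE h. Qed.

Lemma rnorm_gt0 v : v != 0 -> 0 < rnorm v.
Proof.
by move=> v0; rewrite lt0r rnorm_ge0 andbT; apply: contra_neq v0 => /rnorm_eq0.
Qed.

Lemma rnormZ (a : C) v : rnorm (a *: v) = rnorm a * rnorm v.
Proof. by rewrite rnorm.unlock normrZ !normE -rmorphM. Qed.

Lemma complex_gt0P (e : R[i]) : 0 < e -> exists2 d : R, 0 < d & e = d%:C%C.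
Proof.
case: e => a b; rewrite ltcE /= => /andP[/eqP -> a0]; by exists a.
Qed.

Lemma nbhs_rnormP v (A : set V) :
  nbhs v A <-> exists2 d : R, 0 < d & forall w, rnorm (w - v) < d -> A w.
Proof.
split=> [/nbhs_normP[e /= e0 eA]|[d d0 dA]].
  have [d d0 ed] := complex_gt0P e0; exists d => // w wd; apply: eA => /=.
  by rewrite /ball_ /= normE ed ltcR rnorm_sub.
apply/nbhs_normP; exists (d%:C%C); first by rewrite /= ltcR.
by move=> w /=; rewrite normE ltcR rnorm_sub; exact: dA.
Qed.

End Generic.

Section Differentiability.
Variables V W : normedModType R[i].

(** Real epsilon-delta estimates mix better with real arithmetic than Landau
    symbols with values in [R[i]]. *)
Definition has_diff (f : V -> W) (x : V) (L : V -> W) :=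
  forall e : R, 0 < e -> exists2 d : R, 0 < d & forall y, rnorm (y - x) < d ->
    rnorm (f y - f x - L (y - x)) <= e * rnorm (y - x).

Lemma differentiable_has_diff (f : V -> W) (x : V) :
  differentiable f x -> has_diff f x ('d f x).
Proof.
move=> /diff_locally/eqaddoP h e e0.
have eC : 0 < e%:C%C :> R[i] by rewrite ltcR.
have /nbhs_rnormP[d d0 hd] := h _ eC.
exists d => // y yd; have := hd (y - x); rewrite subr0 => /(_ yd) /=.
rewrite /shift /cst /= !normE -rmorphM lecR.
have -> : f y - f x - 'd f x (y - x) = f (y - x + x) - (f x + 'd f x (y - x)).
  by rewrite subrK opprD addrA.
exact.
Qed.

Lemma has_diff_differentiable (f : V -> W) (x : V) (L : {linear V -> W}) :
  continuous L -> has_diff f x L -> differentiable f x.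
Proof.
move=> cL h.
have E : f \o shift x = cst (f x) + L +o_ 0 id.
  apply/eqaddoP => _ /complex_gt0P[e e0 ->].
  have [d d0 hd] := h e e0.
  apply/nbhs_rnormP; exists d => // y; rewrite subr0 => yd.
  rewrite !normE -rmorphM lecR.
  have := hd (y + x); rewrite addrK => /(_ yd).
  by rewrite -addrA -opprD; exact.
by apply/diff_locallyP; rewrite (diff_unique cL E).
Qed.

Lemma differentiable_rnorm_continuous (f : V -> W) (x : V) :
  differentiable f x -> forall e : R, 0 < e ->
  exists2 d : R, 0 < d & forall y, rnorm (y - x) < d -> rnorm (f y - f x) < e.
Proof.
move=> /differentiable_continuous cf e e0.
have /cf : nbhs (f x) [set w | rnorm (w - f x) < e].
  by apply/nbhs_rnormP; exists e.
by move=> /nbhs_rnormP[d d0 hd]; exists d.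
Qed.

End Differentiability.

Section Modulus.
Implicit Types z w : C.

Lemma rnormM z w : rnorm (z * w : C) = rnorm z * rnorm w.
Proof. exact: (rnormZ z w). Qed.

Lemma rnormX z n : rnorm (z ^+ n : C) = rnorm z ^+ n.
Proof.
elim: n => [|n IH]; first by rewrite !expr0 rnorm.unlock normr1.
by rewrite !exprS rnormM IH.
Qed.

Lemma rnorm1 : rnorm (1 : C) = 1.
Proof. by rewrite rnorm.unlock normr1. Qed.

Lemma rnormV z : rnorm (z^-1 : C) = (rnorm z)^-1.
Proof.
have [->|z0] := eqVneq z 0; first by rewrite invr0 rnorm0 invr0.
have n0 := rnorm_gt0 z0.
apply: (mulfI (lt0r_neq0 n0)); rewrite -rnormM.
by rewrite mulfV // mulfV ?lt0r_neq0 // rnorm1.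
Qed.

Lemma rnorm_div z w : rnorm (z / w : C) = rnorm z / rnorm w.
Proof. by rewrite rnormM rnormV. Qed.

Lemma rnorm_sqr z : rnorm z ^+ 2 = re z ^+ 2 + im z ^+ 2.
Proof.
rewrite rnorm.unlock; have -> : `|z| = `|z : R[i]| by [].
by rewrite normc_def /= /re /im sqr_sqrtr // addr_ge0 // sqr_ge0.
Qed.

Lemma rnorm_real (x : R) : rnorm (rc x) = `|x|.
Proof.
apply/eqP; rewrite -(eqrXn2 (n := 2)) ?rnorm_ge0 // rnorm_sqr /= real_normK ?num_real //.
by rewrite expr0n addr0.
Qed.

Lemma ler_re_rnorm z : `|re z| <= rnorm z.
Proof.
rewrite -(ler_pXn2r (n := 2)) ?nnegrE ?rnorm_ge0 // rnorm_sqr real_normK ?num_real //.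
by rewrite lerDl sqr_ge0.
Qed.

Lemma ler_im_rnorm z : `|im z| <= rnorm z.
Proof.
rewrite -(ler_pXn2r (n := 2)) ?nnegrE ?rnorm_ge0 // rnorm_sqr real_normK ?num_real //.
by rewrite lerDr sqr_ge0.
Qed.

Lemma rnorm_le_reim z : rnorm z <= `|re z| + `|im z|.
Proof.
rewrite -(ler_pXn2r (n := 2)) ?nnegrE ?rnorm_ge0 ?addr_ge0 // rnorm_sqr.
rewrite sqrrD !real_normK ?num_real // -addrA lerD2l lerDr.
by rewrite mulrn_wge0 // mulr_ge0.
Qed.

Lemma reD z w : re (z + w) = re z + re w.
Proof. by case: z; case: w. Qed.
Lemma imD z w : im (z + w) = im z + im w.
Proof. by case: z; case: w. Qed.
Lemma reN z : re (- z) = - re z.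
Proof. by case: z. Qed.
Lemma imN z : im (- z) = - im z.
Proof. by case: z. Qed.
Lemma reB z w : re (z - w) = re z - re w.
Proof. by rewrite reD reN. Qed.
Lemma imB z w : im (z - w) = im z - im w.
Proof. by rewrite imD imN. Qed.
Lemma reM z w : re (z * w) = re z * re w - im z * im w.
Proof. by case: z; case: w. Qed.
Lemma imM z w : im (z * w) = re z * im w + im z * re w.
Proof. by case: z => a b; case: w => c d; rewrite /im /re /= (addrC (a * d)). Qed.
Lemma re_rc (x : R) : re (rc x) = x. Proof. by []. Qed.
Lemma im_rc (x : R) : im (rc x) = 0. Proof. by []. Qed.
Lemma re_cnj z : re (cnj z) = re z. Proof. by case: z. Qed.
Lemma im_cnj z : im (cnj z) = - im z. Proof. by case: z. Qed.
Lemma re1 : re (1 : C) = 1. Proof. by []. Qed.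
Lemma im1 : im (1 : C) = 0. Proof. by []. Qed.
Lemma re0 : re (0 : C) = 0. Proof. by []. Qed.
Lemma im0 : im (0 : C) = 0. Proof. by []. Qed.
Lemma re_ci : re (ci R) = 0. Proof. by []. Qed.
Lemma im_ci : im (ci R) = 1. Proof. by []. Qed.

Definition reimE := (reD, imD, reN, imN, reM, imM, re_rc, im_rc, re_cnj, im_cnj,
  re1, im1, re0, im0, re_ci, im_ci).

Lemma eq_reim z w : re z = re w -> im z = im w -> z = w.
Proof. by case: z => a b; case: w => c d; rewrite /re /im /= => -> ->. Qed.

Lemma rnorm_lt1P z : disk z <-> rnorm z < 1.
Proof. by rewrite /disk /= normE -[1]/(1%:C%C : R[i]) ltcR. Qed.

Lemma circleP z : circle z <-> rnorm z = 1.
Proof.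
rewrite /circle /= normE; split=> [/(@complexI _ _ 1) //|->//].
Qed.

End Modulus.

Lemma rnorm_pair (z : C * C) : rnorm z = Num.max (rnorm z.1) (rnorm z.2).
Proof.
case: z => a b /=; have := normE (a, b); rewrite prod_normE /= !normE.
rewrite /Num.max /Order.max ltcR; case: ifP => _ /(@complexI _ _ _) <- //.
Qed.

Lemma bidiskP (z : C * C) : bidisk z <-> rnorm z.1 < 1 /\ rnorm z.2 < 1.
Proof. by rewrite /bidisk /=; split=> -[/rnorm_lt1P ? /rnorm_lt1P ?]. Qed.

(** Points are compact. *)
Lemma cvg_on_compacts_pointwise (V W : normedModType R[i]) (D : set V)
    (u : nat -> V -> W) (g : V -> W) (x : V) :
  cvg_on_compacts D u g -> D x -> forall e : R, 0 < e ->
  exists N, forall n, (N <= n)%N -> rnorm (u n x - g x) < e.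
Proof.
move=> /fam_cvgP ug Dx e e0.
have /ug : compact [set x] /\ [set x] `<=` D.
  by split; [exact: compact_set1|move=> y ->].
rewrite uniform_set1 => cu.
have /cu : nbhs (g x) [set w | rnorm (w - g x) < e].
  by apply/nbhs_rnormP; exists e.
by move=> [N _ hN]; exists N => n /hN.
Qed.

End RealNorm.

(** * Integrals of complex-valued functions along segments *)

Section PathIntegral.
Variable R : realType.
Local Notation C := (Cplx R).
Local Notation mu := (@lebesgue_measure R).
Implicit Types (a b m : R) (u v : R -> C).

Definition ccont a b u := forall s, a <= s <= b -> forall e : R, 0 < e ->
  exists2 d : R, 0 < d & forall t, a <= t <= b -> `|t - s| < d ->
    rnorm (u t - u s) < e.

Definition cint a b u : C := Complex (\int[mu]_(s in `[a, b]) re (u s))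
                                 (\int[mu]_(s in `[a, b]) im (u s)).

Lemma ccontB a b u v : ccont a b u -> ccont a b v ->
  ccont a b (fun s => u s - v s).
Proof.
move=> cu cv s sab e e0.
have e2 : 0 < e / 2 by lra.
have [d d0 hd] := cu s sab _ e2; have [d' d0' hd'] := cv s sab _ e2.
exists (Num.min d d'); first by rewrite lt_min d0.
move=> t tab; rewrite lt_min => /andP[td td'].
have h := hd _ tab td; have h' := hd' _ tab td'.
have -> : u t - v t - (u s - v s) = (u t - u s) - (v t - v s) by ring.
by apply: le_lt_trans (rnormB _ _) _; lra.
Qed.

Lemma ccontM a b u (c : C) : ccont a b u -> ccont a b (fun s => c * u s).
Proof.
move=> cu s sab e e0.
have c0 := rnorm_ge0 c.
have e2 : 0 < e / (rnorm c + 1) by apply: divr_gt0 => //; lra.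
have [d d0 hd] := cu s sab _ e2; exists d => // t tab td.
have := hd _ tab td; rewrite -mulrBr rnormM ltr_pdivlMr; last by lra.
have := rnorm_ge0 (u t - u s); nra.
Qed.

Section RealPart.
Variable part : C -> R.
Hypothesis partB : forall z w, part (z - w) = part z - part w.
Hypothesis part_le : forall z, `|part z| <= rnorm z.

Lemma ccont_integrable a b u : ccont a b u ->
  mu.-integrable `[a, b] (EFin \o (part \o u)).
Proof.
move=> cu; apply: continuous_compact_integrable; first exact: segment_compact.
apply/subspace_continuousP => s /=; rewrite in_itv /= => sab.
apply/cvgrPdist_lt => e e0; have [d d0 hd] := cu s sab e e0.
apply/nbhs_normP; exists d => //= t; rewrite /ball_ /= => ts; rewrite in_itv /= => tab.
have := hd t tab; rewrite distrC => /(_ ts).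
by rewrite distrC -partB; apply: le_lt_trans; apply: part_le.
Qed.

End RealPart.

Let integrable_re a b u (cu : ccont a b u) := ccont_integrable (@reB R) (@ler_re_rnorm R) cu.
Let integrable_im a b u (cu : ccont a b u) := ccont_integrable (@imB R) (@ler_im_rnorm R) cu.

Lemma eq_cint a b u v : (forall s, a <= s <= b -> u s = v s) ->
  cint a b u = cint a b v.
Proof.
move=> uv; rewrite /cint; congr Complex; apply: eq_Rintegral => s;
  by rewrite inE /= in_itv /= => /uv ->.
Qed.

Lemma Rintegral_split a m b (f : R -> R) : a <= m <= b ->
  mu.-integrable `[a, b] (EFin \o f) ->
  \int[mu]_(s in `[a, b]) f s =
  \int[mu]_(s in `[a, m]) f s + \int[mu]_(s in `[m, b]) f s.
Proof.
move=> /andP[am mb] fi.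
have := @Rintegral_itvB R f (BLeft a) (BRight b) m fi.
rewrite !bnd_simp => /(_ am mb) E.
rewrite -[X in _ + X]Rintegral_itv_obnd_cbnd; first by rewrite -E addrCA subrr addr0.
apply: integrableS fi => //.
by apply: subset_itvr; rewrite bnd_simp.
Qed.

Lemma cint_split a m b u : a <= m <= b -> ccont a b u ->
  cint a b u = cint a m u + cint m b u.
Proof.
move=> amb cu; rewrite /cint.
rewrite (Rintegral_split amb (integrable_re cu)) (Rintegral_split amb (integrable_im cu)).
by apply: eq_reim.
Qed.

Lemma cintB a b u v : ccont a b u -> ccont a b v ->
  cint a b (fun s => u s - v s) = cint a b u - cint a b v.
Proof.
move=> cu cv; apply: eq_reim => /=.
  rewrite -(RintegralB _ (integrable_re cu) (integrable_re cv)) //=.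
  by apply: eq_Rintegral => s _; rewrite reB.
rewrite -(RintegralB _ (integrable_im cu) (integrable_im cv)) //=.
by apply: eq_Rintegral => s _; rewrite imB.
Qed.

Lemma cintZ a b u (c : C) : ccont a b u ->
  cint a b (fun s => c * u s) = c * cint a b u.
Proof.
move=> cu; have iR := integrable_re cu; have iI := integrable_im cu.
have mI : measurable (`[a, b] : set R) by [].
have Z (f : R -> R) k : mu.-integrable `[a, b] (EFin \o f) ->
    mu.-integrable `[a, b] (EFin \o (fun s => k * f s)).
  by move=> fi; exact: (integrableZl _ k fi).
have ZE (f : R -> R) k : mu.-integrable `[a, b] (EFin \o f) ->
    \int[mu]_(s in `[a, b]) (k * f s) = k * \int[mu]_(s in `[a, b]) f s.
  by move=> fi; exact: RintegralZl.
have ZR k : k * \int[mu]_(s in `[a, b]) re (u s) =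
    \int[mu]_(s in `[a, b]) (k * re (u s)) by rewrite (ZE _ k iR).
have ZI k : k * \int[mu]_(s in `[a, b]) im (u s) =
    \int[mu]_(s in `[a, b]) (k * im (u s)) by rewrite (ZE _ k iI).
apply: eq_reim.
  rewrite [RHS]reM /= ZR ZI -RintegralB //; [|exact: (Z _ _ iR)|exact: (Z _ _ iI)].
  by apply: eq_Rintegral => s _; rewrite reM.
rewrite [RHS]imM /= ZR ZI -RintegralD //; [|exact: (Z _ _ iI)|exact: (Z _ _ iR)].
by apply: eq_Rintegral => s _; rewrite imM.
Qed.

Lemma lebesgue_segment a b : a <= b -> fine (mu `[a, b]%classic) = b - a.
Proof.
move=> ab; rewrite lebesgue_measure_itv /= lte_fin.
case: ifP => //; rewrite ltNge => /negbFE ba /=.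
by rewrite (@le_anti _ _ a b) ?ab ?ba // subrr.
Qed.

Lemma cint_cst a b (c : C) : a <= b -> cint a b (fun=> c) = rc (b - a) * c.
Proof.
move=> ab; rewrite /cint !Rintegral_cst // lebesgue_segment //.
by apply: eq_reim; rewrite ?reM ?imM /=; ring.
Qed.

Lemma Rintegral_bound a b (f : R -> R) (B : R) : a <= b ->
  mu.-integrable `[a, b] (EFin \o f) ->
  (forall s, a <= s <= b -> `|f s| <= B) ->
  `|\int[mu]_(s in `[a, b]) f s| <= B * (b - a).
Proof.
move=> ab fi fB.
apply: le_trans (le_normr_Rintegral _ fi) _ => //.
rewrite -(lebesgue_segment ab) -Rintegral_cst //.
apply: le_Rintegral => //.
- by have := integrable_norm fi.
- rewrite /comp; apply: continuous_compact_integrable; first exact: segment_compact.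
  by apply: continuous_subspaceT; exact: cst_continuous.
Qed.

Lemma cint_bound a b u (B : R) : a <= b -> ccont a b u ->
  (forall s, a <= s <= b -> rnorm (u s) <= B) ->
  rnorm (cint a b u) <= 2 * B * (b - a).
Proof.
move=> ab cu uB; apply: le_trans (rnorm_le_reim _) _.
have -> : 2 * B * (b - a) = B * (b - a) + B * (b - a) by ring.
apply: lerD.
  apply: (Rintegral_bound ab (integrable_re cu)) => s sab /=.
  exact: le_trans (ler_re_rnorm _) (uB s sab).
apply: (Rintegral_bound ab (integrable_im cu)) => s sab /=.
exact: le_trans (ler_im_rnorm _) (uB s sab).
Qed.

(** Lower bounds are only needed for the period of [1 / z]. *)
Lemma cint_im_ge a b u (B : R) : a <= b -> ccont a b u ->
  (forall s, a <= s <= b -> B <= im (u s)) ->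
  B * (b - a) <= im (cint a b u).
Proof.
move=> ab cu uB; rewrite /= -(lebesgue_segment ab) -Rintegral_cst //.
apply: le_Rintegral => //.
- rewrite /comp; apply: continuous_compact_integrable; first exact: segment_compact.
  by apply: continuous_subspaceT; exact: cst_continuous.
- exact: integrable_im cu.
Qed.

End PathIntegral.

(** * Goursat's theorem for rectangles *)

Section Bisection.
Variable R : realType.
Implicit Types a b c d x y : R.

Lemma half_powers_small (L e : R) : 0 <= L -> 0 < e ->
  exists n : nat, L / 2 ^+ n < e.
Proof.
move=> L0 e0.
have [n hn] : exists n : nat, L / e < n%:R.
  exists (Num.truncn (L / e)).+1.
  have := truncnS_gt (L / e); exact.
exists n; rewrite ltr_pdivrMr ?exprn_gt0 //.
have h2 : (n%:R : R) <= 2 ^+ n.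
  by rewrite -natrX ler_nat ltnW // ltn_expl.
move: hn; rewrite ltr_pdivrMr // => hn; apply: lt_le_trans hn _.
by rewrite mulrC ler_pM2l.
Qed.

(** Otherwise one could choose again and again a bad quarter of a bad rectangle,
    and these quarters would shrink to a point. *)
Lemma rectangle_bisection (P : R -> R -> R -> R -> Prop) a0 b0 c0 d0 :
  a0 <= b0 -> c0 <= d0 ->
  (forall a w c h, 0 <= w -> 0 <= h -> a0 <= a -> a + w + w <= b0 ->
     c0 <= c -> c + h + h <= d0 ->
     P a (a + w) c (c + h) -> P (a + w) (a + w + w) c (c + h) ->
     P a (a + w) (c + h) (c + h + h) -> P (a + w) (a + w + w) (c + h) (c + h + h) ->
     P a (a + w + w) c (c + h + h)) ->
  (forall x y, a0 <= x <= b0 -> c0 <= y <= d0 -> exists2 e, 0 < e &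
     forall a b c d, a0 <= a -> a <= x <= b -> b <= b0 ->
       c0 <= c -> c <= y <= d -> d <= d0 -> (b - a) + (d - c) < e -> P a b c d) ->
  P a0 b0 c0 d0.
Proof.
move=> ab cd hsplit hloc; apply: contrapT => nP.
pose w n := (b0 - a0) / 2 ^+ n; pose h n := (d0 - c0) / 2 ^+ n.
have wS n : w n = w n.+1 + w n.+1 by rewrite /w exprS; field; rewrite expf_neq0.
have hS n : h n = h n.+1 + h n.+1 by rewrite /h exprS; field; rewrite expf_neq0.
have w0 n : 0 <= w n by rewrite divr_ge0 ?exprn_ge0 // subr_ge0.
have h0 n : 0 <= h n by rewrite divr_ge0 ?exprn_ge0 // subr_ge0.
pose bad n (q : R * R) := [/\ a0 <= q.1, q.1 + w n <= b0, c0 <= q.2,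
  q.2 + h n <= d0 & ~ P q.1 (q.1 + w n) q.2 (q.2 + h n)].
pose sub n (q r : R * R) := [/\ q.1 <= r.1, r.1 + w n.+1 <= q.1 + w n,
  q.2 <= r.2 & r.2 + h n.+1 <= q.2 + h n].
have step n q : bad n q -> exists2 r, bad n.+1 r & sub n q r.
  case: q => a c [] /=; rewrite /sub (wS n) (hS n).
  have W0 := w0 n.+1; have H0 := h0 n.+1.
  set W := w n.+1 in W0 *; set H := h n.+1 in H0 *.
  rewrite !addrA => a1 b1 c1 d1 nPq.
  apply: contrapT => none; apply: nPq; apply: hsplit => //;
    apply: contrapT => nPr; apply: none.
  - exists (a, c); split=> //=; rewrite -/W -/H; lra.
  - exists (a + W, c); split=> //=; rewrite -/W -/H; lra.
  - exists (a, c + H); split=> //=; rewrite -/W -/H; lra.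
  - exists (a + W, c + H); split=> //=; rewrite -/W -/H; lra.
have ex nq : exists r, bad nq.1 nq.2 -> bad nq.1.+1 r /\ sub nq.1 nq.2 r.
  case: nq => n q /=; have [/step[r r1 r2]|nb] := pselect (bad n q).
    by exists r.
  by exists q.
have [f hf] := choice ex.
pose fix s n := if n is m.+1 then f (m, s m) else (a0, c0).
have sbad n : bad n (s n).
  elim: n => [|n IH]; last by have [] := hf (n, s n) IH.
  by rewrite /bad /= /w /h expr0 !divr1 !(addrC _ (_ - _)) !subrK; split.
have ssub n : sub n (s n) (s n.+1) by have [] := hf (n, s n) (sbad n).
have nest n k : [/\ (s n).1 <= (s (n + k)%N).1,
    (s (n + k)%N).1 + w (n + k)%N <= (s n).1 + w n,
    (s n).2 <= (s (n + k)%N).2 &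
    (s (n + k)%N).2 + h (n + k)%N <= (s n).2 + h n].
  elim: k => [|k [i1 i2 i3 i4]]; first by rewrite addn0.
  have [j1 j2 j3 j4] := ssub (n + k)%N.
  rewrite addnS; split.
  - exact: le_trans j1.
  - exact: le_trans i2.
  - exact: le_trans j3.
  - exact: le_trans i4.
have cross n m : (s n).1 <= (s m).1 + w m /\ (s n).2 <= (s m).2 + h m.
  have := w0 n; have := w0 m; have := h0 n; have := h0 m.
  case: (leqP n m) => [nm|/ltnW mn].
    by have [] := nest n (m - n)%N; rewrite subnKC // => *; split; lra.
  by have [] := nest m (n - m)%N; rewrite subnKC // => *; split; lra.
pose x := sup (range (fun n => (s n).1)); pose y := sup (range (fun n => (s n).2)).
have ub1 : has_ubound (range (fun n => (s n).1)).
  by exists ((s 0%N).1 + w 0%N) => _ [n _ <-]; have [] := cross n 0%N.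
have ub2 : has_ubound (range (fun n => (s n).2)).
  by exists ((s 0%N).2 + h 0%N) => _ [n _ <-]; have [] := cross n 0%N.
have xin n : (s n).1 <= x <= (s n).1 + w n.
  apply/andP; split; first by apply: ub_le_sup => //; exists n.
  apply: ge_sup; first by exists (s 0%N).1; exists 0%N.
  by move=> _ [m _ <-]; have [] := cross m n.
have yin n : (s n).2 <= y <= (s n).2 + h n.
  apply/andP; split; first by apply: ub_le_sup => //; exists n.
  apply: ge_sup; first by exists (s 0%N).2; exists 0%N.
  by move=> _ [m _ <-]; have [] := cross m n.
have [||e e0 he] := hloc x y.
- by have [b1 b2 _ _ _] := sbad 0%N; have := xin 0%N; lra.
- by have [_ _ b1 b2 _] := sbad 0%N; have := yin 0%N; lra.
have [|n hn] := @half_powers_small ((b0 - a0) + (d0 - c0)) e _ e0; first lra.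
have [b1 b2 b3 b4] := sbad n; apply; apply: he => //; try lra.
move: hn; rewrite mulrDl -/(w n) -/(h n); lra.
Qed.

End Bisection.

Section Rectangles.
Variable R : realType.
Local Notation C := (Cplx R).
Implicit Types (a b c d s t : R) (f g : C -> C) (z w : C).

Definition pt s t : C := Complex s t.

Definition cont_at f z := forall e : R, 0 < e -> exists2 d : R, 0 < d &
  forall w, rnorm (w - z) < d -> rnorm (f w - f z) < e.

(** Opposite sides are grouped, so that constants cancel before integration. *)
Definition rint a b c d f : C :=
  cint a b (fun s => f (pt s c) - f (pt s d)) +
  ci R * cint c d (fun t => f (pt b t) - f (pt a t)).

Lemma rnorm_pt s t : rnorm (pt s t) <= `|s| + `|t|.
Proof. exact: rnorm_le_reim. Qed.

Lemma pt_sub s t s' t' : pt s t - pt s' t' = pt (s - s') (t - t').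
Proof. by []. Qed.

Lemma ccont_horizontal a b t f :
  (forall s, a <= s <= b -> cont_at f (pt s t)) -> ccont a b (fun s => f (pt s t)).
Proof.
move=> cf s sab e e0; have [d d0 hd] := cf s sab e e0.
exists d => // r _ rs; apply: hd; rewrite pt_sub subrr.
by apply: le_lt_trans (rnorm_pt _ _) _; rewrite normr0 addr0.
Qed.

Lemma ccont_vertical c d s f :
  (forall t, c <= t <= d -> cont_at f (pt s t)) -> ccont c d (fun t => f (pt s t)).
Proof.
move=> cf t tcd e e0; have [r r0 hr] := cf t tcd e e0.
exists r => // t' _ tt'; apply: hr; rewrite pt_sub subrr.
by apply: le_lt_trans (rnorm_pt _ _) _; rewrite normr0 add0r.
Qed.

Definition cont_boundary a b c d f := forall s t, a <= s <= b -> c <= t <= d ->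
  [\/ s = a, s = b, t = c | t = d] -> cont_at f (pt s t).

Section Boundary.
Variables (a b c d : R) (f : C -> C).
Hypotheses (ab : a <= b) (cd : c <= d) (cf : cont_boundary a b c d f).

Lemma ccont_bottom : ccont a b (fun s => f (pt s c)).
Proof.
apply: ccont_horizontal => s sab; apply: cf => //; first by rewrite lexx.
by constructor 3.
Qed.
Lemma ccont_top : ccont a b (fun s => f (pt s d)).
Proof.
apply: ccont_horizontal => s sab; apply: cf => //; first by rewrite lexx andbT.
by constructor 4.
Qed.
Lemma ccont_left : ccont c d (fun t => f (pt a t)).
Proof.
apply: ccont_vertical => t tcd; apply: cf => //; first by rewrite lexx.
by constructor 1.
Qed.
Lemma ccont_right : ccont c d (fun t => f (pt b t)).
Proof.
apply: ccont_vertical => t tcd; apply: cf => //; first by rewrite lexx andbT.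
by constructor 2.
Qed.

Lemma rint_bound (B : R) :
  (forall s t, a <= s <= b -> c <= t <= d -> [\/ s = a, s = b, t = c | t = d] ->
    rnorm (f (pt s t)) <= B) ->
  rnorm (rint a b c d f) <= 4 * B * ((b - a) + (d - c)).
Proof.
move=> fB; rewrite mulrDr; apply: le_trans (rnormD _ _) _; apply: lerD.
  have -> : 4 * B * (b - a) = 2 * (B + B) * (b - a) by ring.
  apply: cint_bound => //; first exact: ccontB ccont_bottom ccont_top.
  move=> s sab; apply: le_trans (rnormB _ _) _.
  apply: lerD; apply: fB; rewrite ?lexx ?andbT //; [by constructor 3|by constructor 4].
have -> : 4 * B * (d - c) = 2 * (B + B) * (d - c) by ring.
have -> : rnorm (ci R * cint c d (fun t => f (pt b t) - f (pt a t)) : C) =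
    rnorm (cint c d (fun t => f (pt b t) - f (pt a t))).
  rewrite rnormM; have -> : rnorm (ci R) = 1; last by rewrite mul1r.
  by apply/eqP; rewrite -(eqrXn2 (n := 2)) ?rnorm_ge0 // rnorm_sqr /re /im /=
    expr0n add0r expr1n.
apply: cint_bound => //; first exact: ccontB ccont_right ccont_left.
move=> s sab; apply: le_trans (rnormB _ _) _.
apply: lerD; apply: fB; rewrite ?lexx ?andbT //; [by constructor 2|by constructor 1].
Qed.

Lemma rintZ (k : C) : rint a b c d (fun z => k * f z) = k * rint a b c d f.
Proof.
rewrite /rint.
have -> : cint a b (fun s => k * f (pt s c) - k * f (pt s d)) =
    k * cint a b (fun s => f (pt s c) - f (pt s d)).
  rewrite -cintZ; last exact: ccontB ccont_bottom ccont_top.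
  by apply: eq_cint => s _; rewrite mulrBr.
have -> : cint c d (fun t => k * f (pt b t) - k * f (pt a t)) =
    k * cint c d (fun t => f (pt b t) - f (pt a t)).
  rewrite -cintZ; last exact: ccontB ccont_right ccont_left.
  by apply: eq_cint => t _; rewrite mulrBr.
by ring.
Qed.

End Boundary.

Lemma rintB a b c d f g : a <= b -> c <= d ->
  cont_boundary a b c d f -> cont_boundary a b c d g ->
  rint a b c d (fun z => f z - g z) = rint a b c d f - rint a b c d g.
Proof.
move=> ab cd cf cg; rewrite /rint.
have cfbt := ccontB (ccont_bottom cd cf) (ccont_top cd cf).
have cgbt := ccontB (ccont_bottom cd cg) (ccont_top cd cg).
have cfrl := ccontB (ccont_right ab cf) (ccont_left ab cf).
have cgrl := ccontB (ccont_right ab cg) (ccont_left ab cg).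
rewrite -[X in cint a b X](_ : (fun s => (f (pt s c) - f (pt s d)) -
  (g (pt s c) - g (pt s d))) = _); last by apply/funext => s; ring.
rewrite -[X in cint c d X](_ : (fun t => (f (pt b t) - f (pt a t)) -
  (g (pt b t) - g (pt a t))) = _); last by apply/funext => s; ring.
by rewrite (cintB cfbt cgbt) (cintB cfrl cgrl); ring.
Qed.

Lemma rint_split_vertical a m b c d f : a <= m <= b -> c <= d ->
  cont_boundary a m c d f -> cont_boundary m b c d f ->
  rint a b c d f = rint a m c d f + rint m b c d f.
Proof.
move=> amb cd c1 c2; have /andP[am mb] := amb.
have ch t : t = c \/ t = d -> forall s, a <= s <= b -> cont_at f (pt s t).
  move=> tE s /andP[as_ sb].
  have tcd : c <= t <= d by case: tE => ->; rewrite lexx ?andbT.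
  have [sm|/ltW ms] := lerP s m.
    by apply: c1; rewrite ?as_ ?sm //; case: tE; [constructor 3|constructor 4].
  by apply: c2; rewrite ?ms ?sb //; case: tE; [constructor 3|constructor 4].
have cu : ccont a b (fun s => f (pt s c) - f (pt s d)).
  by apply: ccontB; apply: ccont_horizontal; apply: ch; [left|right].
rewrite /rint (cint_split amb cu).
rewrite -[X in cint c d X](_ : (fun t => (f (pt b t) - f (pt m t)) -
  (f (pt a t) - f (pt m t))) = _); last by apply/funext => s; ring.
have cl := ccont_left am c1; have cm := ccont_right am c1.
have cr := ccont_right mb c2.
by rewrite (cintB (ccontB cr cm) (ccontB cl cm)) (cintB cr cm) (cintB cl cm)
  (cintB cm cl); ring.
Qed.

Lemma rint_split_horizontal a b c m d f : a <= b -> c <= m <= d ->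
  cont_boundary a b c m f -> cont_boundary a b m d f ->
  rint a b c d f = rint a b c m f + rint a b m d f.
Proof.
move=> ab cmd c1 c2; have /andP[cm md] := cmd.
have cv s : s = a \/ s = b -> forall t, c <= t <= d -> cont_at f (pt s t).
  move=> sE t /andP[ct td].
  have sab : a <= s <= b by case: sE => ->; rewrite lexx ?andbT.
  have [tm|/ltW mt] := lerP t m.
    by apply: c1; rewrite ?ct ?tm //; case: sE; [constructor 1|constructor 2].
  by apply: c2; rewrite ?mt ?td //; case: sE; [constructor 1|constructor 2].
have cu : ccont c d (fun t => f (pt b t) - f (pt a t)).
  by apply: ccontB; apply: ccont_vertical; apply: cv; [right|left].
rewrite /rint (cint_split cmd cu).
rewrite -[X in cint a b X](_ : (fun s => (f (pt s c) - f (pt s m)) -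
  (f (pt s d) - f (pt s m))) = _); last by apply/funext => s; ring.
have cb := ccont_bottom cm c1; have cmm := ccont_top cm c1.
have ct := ccont_top md c2.
by rewrite (cintB (ccontB cb cmm) (ccontB ct cmm)) (cintB cb cmm) (cintB ct cmm)
  (cintB cmm ct); ring.
Qed.

Definition cdiff_at f z := exists k : C, forall e : R, 0 < e ->
  exists2 r : R, 0 < r & forall w, rnorm (w - z) < r ->
    rnorm (f w - f z - k * (w - z)) <= e * rnorm (w - z).

Lemma cdiff_cont f z : cdiff_at f z -> cont_at f z.
Proof.
move=> [k hk] e e0; have [r r0 hr] := hk 1 ltr01.
have k0 := rnorm_ge0 k.
have k1 : 0 < rnorm k + 1 by lra.
exists (Num.min r (e / (rnorm k + 1))); first by rewrite lt_min r0 divr_gt0.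
move=> w; rewrite lt_min => /andP[/hr]; rewrite mul1r => hw.
rewrite ltr_pdivlMr // => we.
have -> : f w - f z = (f w - f z - k * (w - z)) + k * (w - z) by ring.
by apply: le_lt_trans (rnormD _ _) _; rewrite rnormM; lra.
Qed.

(** Up to an error of the order of the squared size, [f] is affine on a small
    rectangle, and affine functions integrate to zero. *)
Lemma rint_small a b c d f x y (k : C) (e : R) : 0 <= e ->
  a <= x <= b -> c <= y <= d -> cont_boundary a b c d f ->
  (forall s t, a <= s <= b -> c <= t <= d ->
     rnorm (f (pt s t) - f (pt x y) - k * (pt s t - pt x y)) <=
     e * rnorm (pt s t - pt x y)) ->
  rnorm (rint a b c d f) <= 4 * e * ((b - a) + (d - c)) ^+ 2.
Proof.
move=> e0 xab ycd cf hf.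
have ab : a <= b by lra.
have cd : c <= d by lra.
pose g z := f z - (f (pt x y) + k * (z - pt x y)).
have cg : cont_boundary a b c d g.
  move=> s t sab tcd st r r0.
  have r2 : 0 < r / 2 by lra.
  have [q q0 hq] := cf s t sab tcd st _ r2.
  have k0 := rnorm_ge0 k.
  have k1 : 0 < rnorm k + 1 by lra.
  exists (Num.min q (r / 2 / (rnorm k + 1))); first by rewrite lt_min q0 divr_gt0.
  move=> w; rewrite lt_min => /andP[/hq hw]; rewrite ltr_pdivlMr // => we.
  have -> : g w - g (pt s t) = (f w - f (pt s t)) - k * (w - pt s t).
    by rewrite /g; ring.
  by apply: le_lt_trans (rnormB _ _) _; rewrite rnormM;
    have := rnorm_ge0 (w - pt s t); nra.
have gB s t : a <= s <= b -> c <= t <= d ->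
    rnorm (g (pt s t)) <= e * ((b - a) + (d - c)).
  move=> sab tcd; rewrite /g opprD addrA; apply: le_trans (hf _ _ sab tcd) _.
  apply: ler_wpM2l => //; rewrite pt_sub; apply: le_trans (rnorm_pt _ _) _.
  by apply: lerD; rewrite ler_norml; lra.
have -> : rint a b c d f = rint a b c d g.
  have cl : cont_boundary a b c d (fun z => f z - g z).
    move=> s t sab tcd st r r0.
    have r2 : 0 < r / 2 by lra.
    have [q q0 hq] := cf s t sab tcd st _ r2.
    have [p p0 hp] := cg s t sab tcd st _ r2.
    exists (Num.min p q); first by rewrite lt_min p0.
    move=> w; rewrite lt_min => /andP[/hp h1 /hq h2].
    have -> : f w - g w - (f (pt s t) - g (pt s t)) =
      (f w - f (pt s t)) - (g w - g (pt s t)) by ring.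
    by apply: le_lt_trans (rnormB _ _) _; lra.
  have : rint a b c d (fun z => f z - g z) = 0.
    rewrite /rint (@eq_cint _ a b _ (fun=> - (k * (rc (d - c) * ci R)))); last first.
      move=> s _; rewrite /g; have -> : rc (d - c) * ci R = pt s d - pt s c.
        by apply: eq_reim; rewrite /re /im /=; ring.
      ring.
    rewrite (@eq_cint _ c d _ (fun=> k * rc (b - a))); last first.
      move=> t _; rewrite /g; have -> : rc (b - a) = pt b t - pt a t.
        by apply: eq_reim; rewrite /re /im /=; ring.
      ring.
    by rewrite !cint_cst //; ring.
  by rewrite rintB // => /eqP; rewrite subr_eq0 => /eqP.
have -> : 4 * e * (b - a + (d - c)) ^+ 2 =
  4 * (e * (b - a + (d - c))) * (b - a + (d - c)) by ring.
by apply: rint_bound => // s t sab tcd _; exact: gB.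
Qed.

(** Bisection applies to the bound [e * size ^+ 2] on the integral: it is
    additive over quarters, and holds for small rectangles by differentiability. *)
Theorem goursat a b c d f : a <= b -> c <= d ->
  (forall s t, a <= s <= b -> c <= t <= d -> cdiff_at f (pt s t)) ->
  rint a b c d f = 0.
Proof.
move=> ab cd df.
have cf a' b' c' d' : a <= a' -> b' <= b -> c <= c' -> d' <= d ->
    cont_boundary a' b' c' d' f.
  by move=> ? ? ? ? s t ? ? _; apply/cdiff_cont/df; lra.
suff small (e : R) : 0 < e -> rnorm (rint a b c d f) <= e * (b - a + (d - c)) ^+ 2.
  apply: rnorm_eq0; apply/eqP; rewrite eq_le rnorm_ge0 andbT.
  apply/ler_addgt0Pl => r r0; rewrite addr0.
  have L1 : 0 < (b - a + (d - c)) ^+ 2 + 1 by rewrite ltr_wpDl ?sqr_ge0.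
  apply: le_trans (small (r / ((b - a + (d - c)) ^+ 2 + 1)) _) _; first exact: divr_gt0.
  rewrite mulrAC ler_pdivrMr //; apply: ler_wpM2l; first exact: ltW.
  by rewrite lerDl.
move=> e0.
apply: (@rectangle_bisection R (fun a b c d => rnorm (rint a b c d f) <=
  e * (b - a + (d - c)) ^+ 2)) => //.
  move=> a' w c' h w0 h0 a1 b1 c1 d1.
  have aw : a' <= a' + w <= a' + w + w by lra.
  have ch : c' <= c' + h <= c' + h + h by lra.
  have /andP[aw1 aw2] := aw; have /andP[ch1 ch2] := ch.
  have bw : a' + w <= b by lra.
  have dh : c' + h <= d by lra.
  have a2 : a <= a' + w by lra.
  have c2 : c <= c' + h by lra.
  have c'h : c' <= c' + h + h by lra.
  rewrite (rint_split_vertical aw c'h); [|exact: cf|exact: cf].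
  rewrite (rint_split_horizontal aw1 ch); [|exact: cf|exact: cf].
  rewrite (rint_split_horizontal aw2 ch); [|exact: cf|exact: cf].
  have -> : a' + w - a' = w by ring.
  have -> : c' + h - c' = h by ring.
  have -> : a' + w + w - (a' + w) = w by ring.
  have -> : c' + h + h - (c' + h) = h by ring.
  have -> : a' + w + w - a' + (c' + h + h - c') = 2 * (w + h) by ring.
  move=> h1 h2 h3 h4; have -> : e * (2 * (w + h)) ^+ 2 =
    e * (w + h) ^+ 2 + e * (w + h) ^+ 2 + (e * (w + h) ^+ 2 + e * (w + h) ^+ 2) by ring.
  by apply: le_trans (rnormD _ _) _; apply: lerD;
    apply: le_trans (rnormD _ _) _; apply: lerD.
move=> x y xab ycd; have [k hk] := df x y xab ycd.
have e4 : 0 < e / 4 by lra.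
have [r r0 hr] := hk _ e4; exists r => // a' b' c' d' a1 x1 b1 c1 y1 d1 small.
have -> : e = 4 * (e / 4) by field.
apply: (@rint_small _ _ _ _ f x y k) => //; [lra|exact: cf|].
move=> s t s1 t1; apply: hr; rewrite pt_sub; apply: le_lt_trans (rnorm_pt _ _) _.
apply: le_lt_trans small; apply: lerD; rewrite ler_norml; lra.
Qed.

End Rectangles.

(** * Cauchy's formula on squares *)

Section Differentiable.
Variable R : realType.
Local Notation C := (Cplx R).

Section Algebra.
Variable V : normedModType R[i].
Implicit Types (f g : V -> C) (x : V).

Lemma diff_const (k : C) x : differentiable (fun _ : V => k) x.
Proof. exact: differentiable_cst. Qed.

Lemma diff_add f g x : differentiable f x -> differentiable g x ->
  differentiable (fun z => f z + g z) x.
Proof. exact: differentiableD. Qed.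

Lemma diff_sub f g x : differentiable f x -> differentiable g x ->
  differentiable (fun z => f z - g z) x.
Proof. exact: differentiableB. Qed.

Lemma diff_mul f g x : differentiable f x -> differentiable g x ->
  differentiable (fun z => f z * g z) x.
Proof. exact: differentiableM. Qed.

Lemma diff_exp f n x : differentiable f x -> differentiable (fun z => f z ^+ n) x.
Proof.
move=> df; elim: n => [|n IH]; first exact: diff_const.
have -> : (fun z => f z ^+ n.+1) = (fun z => f z * f z ^+ n); last exact: diff_mul.
by apply/funext => z; rewrite exprS.
Qed.

Lemma diff_div f g x : differentiable f x -> differentiable g x -> g x != 0 ->
  differentiable (fun z => f z / g z) x.
Proof. by move=> df dg g0; apply: diff_mul => //; exact: differentiableV. Qed.

End Algebra.

Lemma diff_id (z : C) : differentiable (fun w : C => w) z.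
Proof. exact: ex_diff. Qed.

Lemma cdiffP (f : C -> C) (z : C) : differentiable f z <-> cdiff_at f z.
Proof.
split=> [/differentiable_has_diff df|[k hk]].
  exists ('d f z 1) => e e0; have [d d0 hd] := df e e0; exists d => // w wz.
  have := hd w wz; rewrite -{1}[w - z]mulr1 -[(w - z) * 1]/((w - z) *: (1 : C)).
  by rewrite linearZ /= -[(w - z) *: _]/((w - z) * _) (mulrC (w - z)).
have dk : is_diff (0 : C) ( *:%R k : C -> C) ( *:%R k : C -> C) by apply: is_diff_scaler.
apply: (@has_diff_differentiable _ _ _ f z ('d ( *:%R k : C -> C) (0 : C))).
  by apply: diff_continuous; exact: ex_diff.
by rewrite diff_val.
Qed.

End Differentiable.

Section Cauchy.
Variable R : realType.
Local Notation C := (Cplx R).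
Implicit Types (f g : C -> C) (a z w : C) (r : R).

Lemma pt_reim z : pt (re z) (im z) = z.
Proof. by case: z. Qed.

Definition sint (a : C) r f : C :=
  rint (re a - r) (re a + r) (im a - r) (im a + r) f.

Lemma rnorm_maxcoord z r : r <= `|re z| \/ r <= `|im z| -> r <= rnorm z.
Proof.
by case=> h; apply: le_trans h _; [exact: ler_re_rnorm|exact: ler_im_rnorm].
Qed.

Lemma edge_cases (A B C' D s t : R) : [\/ s = A, s = B, t = C' | t = D] ->
  (s = A \/ s = B) \/ (t = C' \/ t = D).
Proof. by case; auto. Qed.

Lemma boundary_far (a b : C) r q s t :
  `|re b - re a| <= r - q -> `|im b - im a| <= r - q ->
  [\/ s = re a - r, s = re a + r, t = im a - r | t = im a + r] ->
  q <= rnorm (pt s t - b).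
Proof.
rewrite !ler_norml => h1 h2 /edge_cases st; apply: rnorm_maxcoord.
rewrite reB imB /re /im /= -/(re b) -/(im b).
have N (x : R) : q <= x \/ q <= - x -> q <= `|x|.
  by case=> h; [exact: le_trans (ler_norm _)|rewrite -normrN; exact: le_trans (ler_norm _)].
by case: st => -[->|->]; [left|left|right|right]; apply: N; [right|left|right|left]; lra.
Qed.

(** The rectangles to the left, to the right, below and above the inner one
    contribute zero by Goursat's theorem. *)
Lemma rint_shrink g A0 A1 A2 A3 C0 C1 C2 C3 x y :
  A0 <= A1 -> A1 < x -> x < A2 -> A2 <= A3 ->
  C0 <= C1 -> C1 < y -> y < C2 -> C2 <= C3 ->
  (forall s t, A0 <= s <= A3 -> C0 <= t <= C3 -> s != x \/ t != y ->
     cdiff_at g (pt s t)) ->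
  rint A0 A3 C0 C3 g = rint A1 A2 C1 C2 g.
Proof.
move=> a01 a1x ax2 a23 c01 c1y cy2 c23 dg.
have a12 : A1 <= A2 by apply: ltW; apply: lt_trans ax2.
have c12 : C1 <= C2 by apply: ltW; apply: lt_trans cy2.
have a13 := le_trans a12 a23; have a02 := le_trans a01 a12.
have c13 := le_trans c12 c23; have c02 := le_trans c01 c12.
have a03 := le_trans a01 a13; have c03 := le_trans c01 c13.
have n0 : A0 != x by rewrite lt_eqF // (le_lt_trans a01).
have n1 : A1 != x by rewrite lt_eqF.
have n2 : A2 != x by rewrite gt_eqF.
have n3 : A3 != x by rewrite gt_eqF // (lt_le_trans ax2).
have m0 : C0 != y by rewrite lt_eqF // (le_lt_trans c01).
have m1 : C1 != y by rewrite lt_eqF.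
have m2 : C2 != y by rewrite gt_eqF.
have m3 : C3 != y by rewrite gt_eqF // (lt_le_trans cy2).
have inside (L U l u q : R) : L <= l -> u <= U -> l <= q <= u -> L <= q <= U.
  by move=> Ll uU /andP[lq qu]; rewrite (le_trans Ll lq) (le_trans qu uU).
have cg A B C' D : A0 <= A -> B <= A3 -> C0 <= C' -> D <= C3 ->
   A != x -> B != x -> C' != y -> D != y -> cont_boundary A B C' D g.
  move=> A1' B1 C1' D1 Ab Bb Cb Db s t sAB tCD st; apply: cdiff_cont; apply: dg.
  - exact: inside sAB.
  - exact: inside tCD.
  - by case: st => ->; [left|left|right|right].
have Z A B C' D : A <= B -> C' <= D -> A0 <= A -> B <= A3 -> C0 <= C' -> D <= C3 ->
   (B < x \/ x < A) \/ (D < y \/ y < C') -> rint A B C' D g = 0.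
  move=> AB CD A1' B1 C1' D1 out; apply: goursat => // s t sAB tCD; apply: dg.
  - exact: inside sAB.
  - exact: inside tCD.
  have /andP[As sB] := sAB; have /andP[Ct tD] := tCD.
  case: out => -[] out.
  - by left; rewrite lt_eqF // (le_lt_trans sB).
  - by left; rewrite gt_eqF // (lt_le_trans out).
  - by right; rewrite lt_eqF // (le_lt_trans tD).
  - by right; rewrite gt_eqF // (lt_le_trans out).
have v1 : A0 <= A1 <= A3 by rewrite a01 a13.
have v2 : A1 <= A2 <= A3 by rewrite a12 a23.
have u1 : C0 <= C1 <= C3 by rewrite c01 c13.
have u2 : C1 <= C2 <= C3 by rewrite c12 c23.
rewrite (rint_split_vertical v1 c03); [|exact: cg|exact: cg].
rewrite (rint_split_vertical v2 c03); [|exact: cg|exact: cg].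
rewrite (rint_split_horizontal a12 u1); [|exact: cg|exact: cg].
rewrite (rint_split_horizontal a12 u2); [|exact: cg|exact: cg].
rewrite (Z A0 A1 C0 C3) //; last by left; left.
rewrite (Z A2 A3 C0 C3) //; last by left; right.
rewrite (Z A1 A2 C0 C1) //; last by right; left.
rewrite (Z A1 A2 C2 C3) //; last by right; right.
by rewrite !add0r !addr0.
Qed.

(** A singularity may be enclosed by any smaller square. *)
Lemma sint_shrink g (a b : C) r e :
  `|re b - re a| <= r - e -> `|im b - im a| <= r - e -> 0 < e ->
  (forall s t, re a - r <= s <= re a + r -> im a - r <= t <= im a + r ->
     pt s t != b -> cdiff_at g (pt s t)) ->
  sint a r g = sint b e g.
Proof.
rewrite !ler_norml => h1 h2 e0 dg.
apply: (@rint_shrink g _ _ _ _ _ _ _ _ (re b) (im b)); try lra.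
move=> s t s1 t1 st; apply: dg => //.
by case: st => h; apply: contra_neq h => <-.
Qed.

Lemma sint_bound (a : C) r f (B : R) : 0 <= r ->
  cont_boundary (re a - r) (re a + r) (im a - r) (im a + r) f ->
  (forall s t, re a - r <= s <= re a + r -> im a - r <= t <= im a + r ->
    [\/ s = re a - r, s = re a + r, t = im a - r | t = im a + r] ->
    rnorm (f (pt s t)) <= B) ->
  rnorm (sint a r f) <= 16 * B * r.
Proof.
move=> r0 cf fB; have -> : 16 * B * r =
  4 * B * ((re a + r - (re a - r)) + (im a + r - (im a - r))) by ring.
by apply: rint_bound => //; lra.
Qed.

Definition square (a : C) r : set C :=
  [set z | `|re z - re a| <= r /\ `|im z - im a| <= r].

Lemma square_pt a r s t : square a r (pt s t) <->
  (re a - r <= s <= re a + r /\ im a - r <= t <= im a + r).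
Proof. rewrite /square /= !ler_norml.
by split=> -[? ?]; split; lra. Qed.

(** The exact value [2 * pi * i] is not computed, because only bounds of its
    modulus are used. *)
Definition period (a : C) r (b : C) : C := sint a r (fun z => 1 / (z - b)).

Section Kernel.
Variables (a b : C) (r e : R) (f : C -> C).
Hypotheses (e0 : 0 < e) (b1 : `|re b - re a| <= r - e) (b2 : `|im b - im a| <= r - e).
Hypothesis df : forall z, square a r z -> differentiable f z.

Let r0 : 0 <= r.
Proof. by have := le_trans (normr_ge0 _) b1; rewrite subr_ge0; apply: le_trans; exact: ltW. Qed.

Let dker z : square a r z -> z != b ->
  differentiable (fun z => (f z - f b) / (z - b)) z.
Proof.
move=> qz zb; apply: diff_div; last by rewrite subr_eq0.
  by apply: diff_sub; [exact: df|exact: diff_const].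
by apply: diff_sub; [exact: diff_id|exact: diff_const].
Qed.

Let sqb : square a r b.
Proof. by split; apply: le_trans (_ : r - e <= r); rewrite ?gerBl ?(ltW e0). Qed.

Lemma cont_boundary_kernel (h : C -> C) :
  (forall z, square a r z -> z != b -> differentiable h z) ->
  cont_boundary (re a - r) (re a + r) (im a - r) (im a + r) h.
Proof.
move=> dh s t s1 t1 st; apply/cdiff_cont/cdiffP; apply: dh; first exact/square_pt.
apply/negP => /eqP E; have := boundary_far b1 b2 st.
by rewrite E subrr rnorm0 leNgt e0.
Qed.

(** The difference quotient at [b] is bounded near [b], so that its integral
    over shrinking squares tends to zero. *)
Lemma sint_quotient : sint a r (fun z => (f z - f b) / (z - b)) = 0.
Proof.
have eg0 := e0; have rg0 := r0.
set k := fun z => _.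
have [D hD] : cdiff_at f b by apply/cdiffP/df.
have [d d0 hd] := hD 1 ltr01.
have D0 := rnorm_ge0 D.
have kB z : z != b -> rnorm (z - b) < d -> rnorm (k z) <= rnorm D + 1.
  move=> zb zd; rewrite /k rnorm_div ler_pdivrMr ?rnorm_gt0 ?subr_eq0 //.
  have -> : f z - f b = (f z - f b - D * (z - b)) + D * (z - b) by ring.
  apply: le_trans (rnormD _ _) _; rewrite rnormM.
  by have := hd z zd; lra.
have small q : 0 < q -> q <= e -> 2 * q < d -> rnorm (sint a r k) <= 16 * (rnorm D + 1) * q.
  move=> q0 qe qd.
  have sh : sint a r k = sint b q k.
    apply: sint_shrink => //; [by apply: le_trans b1 _; lra|by apply: le_trans b2 _; lra|].
    by move=> s t s1 t1 ptb; apply/cdiffP; apply: dker => //; apply/square_pt.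
  rewrite sh; have near s t : re b - q <= s <= re b + q -> im b - q <= t <= im b + q ->
      [\/ s = re b - q, s = re b + q, t = im b - q | t = im b + q] ->
      pt s t != b /\ rnorm (pt s t - b) < d.
    move=> s1 t1 st; split.
      apply/negP => /eqP E; have := @boundary_far b b q q s t.
      by rewrite !subrr normr0 lexx E subrr rnorm0 => /(_ isT isT st); lra.
    rewrite -(pt_reim b) pt_sub; apply: le_lt_trans (rnorm_pt _ _) _.
    apply: le_lt_trans qd; rewrite mulr2n mulrDl mul1r; apply: lerD; rewrite ler_norml; lra.
  apply: sint_bound => //; first lra.
    move=> s t s1 t1 st; have [pb _] := near s t s1 t1 st.
    apply/cdiff_cont/cdiffP; apply: dker => //; apply/square_pt.
    by move: b1 b2; rewrite !ler_norml; lra.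
  by move=> s t s1 t1 st; have [pb pd] := near s t s1 t1 st; exact: kB.
apply: rnorm_eq0; apply/eqP; rewrite eq_le rnorm_ge0 andbT.
apply/ler_addgt0Pl => q q0; rewrite addr0.
pose m := Num.min e (Num.min (d / 3) (q / (16 * (rnorm D + 1)))).
have D1 : 0 < 16 * (rnorm D + 1) by lra.
have m0 : 0 < m by rewrite !lt_min e0 !divr_gt0.
have [m1 m2 m3] : [/\ m <= e, m <= d / 3 & m <= q / (16 * (rnorm D + 1))].
  by rewrite /m; split; rewrite !ge_min lexx ?orbT.
apply: le_trans (small m m0 m1 _) _; first lra.
by rewrite mulrC -ler_pdivlMr.
Qed.

Lemma cauchy_square : sint a r (fun z => f z / (z - b)) = f b * period a r b.
Proof.
have dz z : differentiable (fun z : C => z - b) z.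
  by apply: diff_sub; [exact: diff_id|exact: diff_const].
have c1 : cont_boundary (re a - r) (re a + r) (im a - r) (im a + r)
    (fun z => f z / (z - b)).
  by apply: cont_boundary_kernel => z qz zb; apply: diff_div; rewrite ?subr_eq0 //; exact: df.
have c2 : cont_boundary (re a - r) (re a + r) (im a - r) (im a + r)
    (fun z => 1 / (z - b)).
  by apply: cont_boundary_kernel => z qz zb; apply: diff_div; rewrite ?subr_eq0 //; exact: diff_const.
have c3 : cont_boundary (re a - r) (re a + r) (im a - r) (im a + r)
    (fun z => f b * (1 / (z - b))).
  apply: cont_boundary_kernel => z qz zb; apply: diff_mul; first exact: diff_const.
  by apply: diff_div; rewrite ?subr_eq0 //; exact: diff_const.
have qr := r0.
have ra : re a - r <= re a + r by lra.
have ia : im a - r <= im a + r by lra.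
apply/eqP; rewrite -subr_eq0 /period /sint -(rintZ ra ia c2) -(rintB ra ia c1 c3).
rewrite -sint_quotient /sint; apply/eqP; congr rint.
by apply/funext => z; rewrite mul1r -mulrBl.
Qed.

End Kernel.

Lemma diff_kernel b z : z != b -> differentiable (fun z : C => 1 / (z - b)) z.
Proof.
move=> zb; apply: diff_div; [exact: diff_const| |by rewrite subr_eq0].
by apply: diff_sub; [exact: diff_id|exact: diff_const].
Qed.

(** On each of the two pairs of sides of a small square around [b] the integrand
    has imaginary part at least [1 / e], over a length [2 * e]. *)
Lemma period_ge (a b : C) r e : 0 < e ->
  `|re b - re a| <= r - e -> `|im b - im a| <= r - e ->
  4 <= rnorm (period a r b).
Proof.
move=> e0 b1 b2.
have -> : period a r b = sint b e (fun z => 1 / (z - b)).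
  by apply: sint_shrink => // s t _ _ ptb; apply/cdiffP/diff_kernel.
have e2 : `|re b - re b| <= e - e by rewrite !subrr normr0.
have e3 : `|im b - im b| <= e - e by rewrite !subrr normr0.
have cb : cont_boundary (re b - e) (re b + e) (im b - e) (im b + e)
    (fun z => 1 / (z - b)).
  by apply: (@cont_boundary_kernel b b e e e0 e2 e3) => z _; exact: diff_kernel.
have ra : re b - e <= re b + e by lra.
have ia : im b - e <= im b + e by lra.
apply: le_trans (le_trans (ler_norm _) (ler_im_rnorm _)).
have inv1 (x y : R) : x ^+ 2 + y ^+ 2 != 0 ->
    1 / (pt x y) = pt (x / (x ^+ 2 + y ^+ 2)) (- y / (x ^+ 2 + y ^+ 2)) :> C.
  by move=> h; rewrite mul1r /pt; apply: eq_reim; rewrite /re /im /= ?mulNr.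
have pe x : x ^+ 2 <= e ^+ 2 -> 1 / e <= 2 * e / (x ^+ 2 + e ^+ 2).
  move=> xe; rewrite ler_pdivrMr // mulrAC ler_pdivlMr; nra.
have sq (x y : R) : y - e <= x <= y + e -> (x - y) ^+ 2 <= e ^+ 2 by nra.
have pos (x : R) : x ^+ 2 + e ^+ 2 != 0 by rewrite gt_eqF //; nra.
have pos' (x : R) : e ^+ 2 + x ^+ 2 != 0 by rewrite gt_eqF //; nra.
have r1 : 2 <= im (cint (re b - e) (re b + e) (fun s =>
    1 / (pt s (im b - e) - b) - 1 / (pt s (im b + e) - b))).
  have -> : 2 = 1 / e * (re b + e - (re b - e)) by field; rewrite gt_eqF.
  apply: cint_im_ge => //; first exact: ccontB (ccont_bottom ia cb) (ccont_top ia cb).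
  move=> s s1.
  have -> : pt s (im b - e) - b = pt (s - re b) (- e).
    by apply: eq_reim; rewrite ?reB ?imB /re /im /=; ring.
  have -> : pt s (im b + e) - b = pt (s - re b) e.
    by apply: eq_reim; rewrite ?reB ?imB /re /im /=; ring.
  rewrite (inv1 _ _ (pos _)) inv1 ?sqrrN // imB [im (pt _ _)]/= [im (pt _ _)]/=.
  apply: le_trans (pe _ (sq _ _ s1)) _; rewrite le_eqVlt; apply/orP; left; apply/eqP.
  by field; exact: pos.
have r2 : 2 <= re (cint (im b - e) (im b + e) (fun t =>
    1 / (pt (re b + e) t - b) - 1 / (pt (re b - e) t - b))).
  have -> : re (cint (im b - e) (im b + e) (fun t =>
    1 / (pt (re b + e) t - b) - 1 / (pt (re b - e) t - b))) =
    im (ci R * (cint (im b - e) (im b + e) (fun t =>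
    1 / (pt (re b + e) t - b) - 1 / (pt (re b - e) t - b)))).
    by rewrite !reimE; ring.
  have cc := ccontB (ccont_right ra cb) (ccont_left ra cb).
  rewrite -cintZ //.
  have -> : 2 = 1 / e * (im b + e - (im b - e)) by field; rewrite gt_eqF.
  apply: cint_im_ge => //; first exact: ccontM.
  move=> t t1.
  have -> : pt (re b - e) t - b = pt (- e) (t - im b).
    by apply: eq_reim; rewrite ?reB ?imB /re /im /=; ring.
  have -> : pt (re b + e) t - b = pt e (t - im b).
    by apply: eq_reim; rewrite ?reB ?imB /re /im /=; ring.
  rewrite (inv1 _ _ (pos' _)) inv1 ?sqrrN // imM re_ci im_ci reB.
  rewrite [re (pt _ _)]/= [re (pt _ _)]/=.
  apply: le_trans (pe _ (sq _ _ t1)) _; rewrite le_eqVlt; apply/orP; left; apply/eqP.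
  by field; exact: pos'.
rewrite /sint /rint imD imM re_ci im_ci; lra.
Qed.

Lemma period_le (a b : C) r : 0 < r ->
  `|re b - re a| <= r / 2 -> `|im b - im a| <= r / 2 ->
  rnorm (period a r b) <= 32.
Proof.
move=> r0 b1 b2; have r2 : 0 < r / 2 by lra.
have b1' : `|re b - re a| <= r - r / 2 by lra.
have b2' : `|im b - im a| <= r - r / 2 by lra.
have -> : 32 = 16 * (1 / (r / 2)) * r by field; rewrite gt_eqF.
apply: sint_bound; first exact: ltW.
  by apply: (cont_boundary_kernel r2 b1' b2') => z _; exact: diff_kernel.
move=> s t _ _ st; rewrite rnorm_div rnorm1 !mul1r.
have h := boundary_far b1' b2' st.
by rewrite lef_pV2 // posrE; lra.
Qed.

End Cauchy.

(** * The maximum principle *)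

Section MaximumPrinciple.
Variable R : realType.
Local Notation C := (Cplx R).
Implicit Types (f : C -> C) (a z w : C) (r x y : R).

(** Multiplicative constants disappear when an estimate holds for all powers. *)
Lemma le_of_powers x y (K : R) : 0 <= x -> 0 <= y ->
  (forall n : nat, x ^+ n <= K * y ^+ n) -> x <= y.
Proof.
move=> x0 y0 h; rewrite leNgt; apply/negP => yx.
have xp : 0 < x by apply: le_lt_trans yx.
have [yz|yp] := eqVneq y 0.
  by have := h 1%N; rewrite !expr1 yz mulr0 leNgt xp.
have {}yp : 0 < y by rewrite lt0r yp.
pose q := x / y.
have q1 : 0 < q - 1 by rewrite subr_gt0 /q ltr_pdivlMr ?mul1r.
have hq n : q ^+ n <= K by rewrite /q expr_div_n ler_pdivrMr ?exprn_gt0.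
have [n hn] : exists n : nat, K / (q - 1) < n%:R.
  by exists (Num.truncn (K / (q - 1))).+1; exact: truncnS_gt.
have bern m (u : R) : 0 <= u -> 1 + m%:R * u <= (1 + u) ^+ m.
  move=> u0; elim: m => [|m IH]; first by rewrite mul0r addr0 expr0.
  have u1 : 0 <= 1 + u by lra.
  rewrite exprS -natr1; apply: le_trans (ler_wpM2l u1 IH).
  have uu : 0 <= m%:R * u * u by rewrite !mulr_ge0 // ler0n.
  lra.
have := bern n _ (ltW q1); rewrite [1 + (q - 1)]addrC subrK => /le_trans/(_ (hq n)); move: hn; rewrite ltr_pdivrMr //; lra.
Qed.

(** Cauchy's formula at the centre, where the kernel is of size [1 / r] on the
    boundary and the period is at least [4]. *)
Lemma rnorm_center_crude f r (B : R) : 0 < r ->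
  (forall z, square 0 r z -> differentiable f z) ->
  (forall s t, - r <= s <= r -> - r <= t <= r ->
     [\/ s = - r, s = r, t = - r | t = r] -> rnorm (f (pt s t)) <= B) ->
  rnorm (f 0) <= 4 * B.
Proof.
move=> r0 df fB.
have z1 : `|re (0 : C) - re (0 : C)| <= r - r by rewrite !subrr normr0.
have z2 : `|im (0 : C) - im (0 : C)| <= r - r by rewrite !subrr normr0.
have := cauchy_square r0 z1 z2 df; move/(congr1 (@rnorm R _)); rewrite rnormM => E.
have P := period_ge r0 z1 z2.
have : rnorm (sint 0 r (fun z => f z / (z - 0))) <= 16 * (B / r) * r.
  apply: sint_bound; first exact: ltW.
    apply: (cont_boundary_kernel r0 z1 z2) => z qz z0.
    apply: diff_div; [exact: df| |by rewrite subr_eq0].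
    by apply: diff_sub; [exact: diff_id|exact: diff_const].
  move=> s t s1 t1 st; have far := boundary_far z1 z2 st.
  move: s1 t1 st; rewrite re0 im0 !add0r => s1 t1 st.
  rewrite rnorm_div; apply: ler_pM => //.
  - exact: rnorm_ge0.
  - by rewrite invr_ge0 rnorm_ge0.
  - exact: fB.
  - by rewrite lef_pV2 // posrE // (lt_le_trans r0).
rewrite E; have -> : 16 * (B / r) * r = 16 * B by field; rewrite gt_eqF.
by have := ler_wpM2l (rnorm_ge0 (f 0)) P; lra.
Qed.

(** The constant is removed by applying the crude bound to powers of [f]. *)
Lemma rnorm_center f r (B : R) : 0 < r ->
  (forall z, square 0 r z -> differentiable f z) ->
  (forall s t, - r <= s <= r -> - r <= t <= r ->
     [\/ s = - r, s = r, t = - r | t = r] -> rnorm (f (pt s t)) <= B) ->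
  rnorm (f 0) <= B.
Proof.
move=> r0 df fB.
have B0 : 0 <= B.
  apply: le_trans (rnorm_ge0 _) (fB r r _ _ _); try lra.
  by constructor 2.
apply: (@le_of_powers _ _ 4); [exact: rnorm_ge0|exact: B0|move=> n].
rewrite -rnormX; apply: (@rnorm_center_crude (fun z => f z ^+ n) r _ r0).
  by move=> z qz; apply: diff_exp; exact: df.
by move=> s t s1 t1 st; rewrite rnormX lerXn2r ?nnegrE ?rnorm_ge0 //; exact: fB.
Qed.

Lemma diff_affine (a k z : C) f : differentiable f (a + k * z) ->
  differentiable (fun w => f (a + k * w)) z.
Proof.
move=> df.
have da : differentiable (fun w : C => a + k * w) z; last exact: (differentiable_comp da df).
by apply: diff_add; [exact: diff_const|apply: diff_mul; [exact: diff_const|exact: diff_id]].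
Qed.

(** Multiplying the four rotations of [f] spreads a bound on one side of a
    square to all of its boundary. *)
Lemma rnorm_center_side f a r (M B : R) : 0 < r ->
  (forall z, square a r z -> differentiable f z) ->
  (forall z, square a r z -> rnorm (f z) <= M) ->
  (forall t, - r <= t <= r -> rnorm (f (a + pt r t)) <= B) ->
  rnorm (f a) ^+ 4 <= B * M ^+ 3.
Proof.
move=> r0 df fM fB.
pose i : C := ci R.
have ii : i * i = -1 by apply: eq_reim; rewrite !reimE; ring.
pose g z := f (a + 1 * z) * f (a + i * z) * (f (a + (-1) * z) * f (a + (- i) * z)).
have sq0 k z : k = 1 \/ k = i \/ k = -1 \/ k = - i -> square 0 r z -> square a r (a + k * z).
  rewrite /square /= !subr0 => kE [h1 h2].
  have -> : re (a + k * z) - re a = re (k * z) by rewrite !reimE; ring.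
  have -> : im (a + k * z) - im a = im (k * z) by rewrite !reimE; ring.
  by case: kE => [->|[->|[->|->]]]; rewrite !reimE;
    rewrite ?(mul0r, mul1r, sub0r, add0r, addr0, subr0, mulN1r, mulNr, oppr0, normrN, opprK).
have g0 : rnorm (g 0) = rnorm (f a) ^+ 4.
  by rewrite /g !mulr0 addr0 !rnormM !exprS expr0; ring.
rewrite -g0; apply: (@rnorm_center g r _ r0).
  move=> z qz; apply: diff_mul; apply: diff_mul; apply: diff_affine; apply: df;
    apply: sq0; tauto.
move=> s t s1 t1 st.
have qz : square 0 r (pt s t).
  by rewrite /square /re /im /= !subr0 !ler_norml.
have M0 : 0 <= M by apply: le_trans (rnorm_ge0 _) (fM _ (sq0 1 _ _ qz)); left.
have B0 : 0 <= B by apply: le_trans (rnorm_ge0 _) (fB r _); lra.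
have n0 z := rnorm_ge0 (f z).
have k1 := fM _ (sq0 1 _ (or_introl erefl) qz).
have k2 := fM _ (sq0 i _ (or_intror (or_introl erefl)) qz).
have k3 := fM _ (sq0 (-1) _ (or_intror (or_intror (or_introl erefl))) qz).
have k4 := fM _ (sq0 (- i) _ (or_intror (or_intror (or_intror erefl))) qz).
rewrite /g !rnormM.
have prod4 (u1 u2 u3 u4 : R) : 0 <= u1 -> 0 <= u2 -> 0 <= u3 -> 0 <= u4 ->
    u1 <= B -> u2 <= M -> u3 <= M -> u4 <= M -> u1 * u2 * (u3 * u4) <= B * M ^+ 3.
  move=> p1 p2 p3 p4 q1 q2 q3 q4; have -> : B * M ^+ 3 = B * M * (M * M) by ring.
  by apply: ler_pM; rewrite ?mulr_ge0 //; apply: ler_pM.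
have pE (k : C) u : k * pt s t = pt r u -> - r <= u <= r -> rnorm (f (a + k * pt s t)) <= B.
  by move=> -> u1; exact: fB.
case: st => E.
- rewrite mulrC; apply: (prod4 _ _ _ _ (n0 _) (n0 _) (n0 _) (n0 _) _ k4 k1 k2).
  by apply: (pE _ (- t)); [rewrite E; apply: eq_reim; rewrite !reimE /re /im /=; ring|lra].
- apply: (prod4 _ _ _ _ (n0 _) (n0 _) (n0 _) (n0 _) _ k2 k3 k4).
  by apply: (pE _ t); [rewrite E; apply: eq_reim; rewrite !reimE /re /im /=; ring|lra].
- rewrite (mulrC (rnorm (f (a + 1 * _)))).
  apply: (prod4 _ _ _ _ (n0 _) (n0 _) (n0 _) (n0 _) _ k1 k3 k4).
  by apply: (pE _ s); [rewrite E; apply: eq_reim; rewrite !reimE /re /im /=; ring|lra].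
- rewrite mulrC (mulrC (rnorm (f (a + -1 * _)))).
  apply: (prod4 _ _ _ _ (n0 _) (n0 _) (n0 _) (n0 _) _ k3 k1 k2).
  by apply: (pE _ (- s)); [rewrite E; apply: eq_reim; rewrite !reimE /re /im /=; ring|lra].
Qed.

Let modulus f (p : R * R) : R := rnorm (f (pt p.1 p.2)).

Lemma continuous_modulus f (p : R * R) : differentiable f (pt p.1 p.2) ->
  {for p, continuous (modulus f)}.
Proof.
move=> /differentiable_rnorm_continuous cf; apply/cvgrPdist_lt => e e0.
have [d d0 hd] := cf e e0.
have d2 : 0 < d / 2 by lra.
apply: filterS (nbhsx_ballx p _ d2) => q [q1 q2].
have qd : rnorm (pt q.1 q.2 - pt p.1 p.2) < d.
  rewrite pt_sub; apply: le_lt_trans (rnorm_pt _ _) _.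
  move: q1 q2; rewrite /ball /= => q1 q2; rewrite distrC (distrC q.2); lra.
have := hd _ qd; rewrite /modulus.
set u := f (pt q.1 q.2); set v := f (pt p.1 p.2) => uv.
have := rnormD (u - v) v; have := rnormD (v - u) u; rewrite !subrK (rnorm_sub v) => h1 h2.
rewrite ltr_norml; lra.
Qed.

(** Among the points where the modulus is maximal, consider one with largest
    real part. If it were interior, a small square around it would have the
    maximal modulus at its centre but not on its right side. *)
Theorem maximum_principle f (rho B : R) : 0 < rho < 1 ->
  (forall z, rnorm z < 1 -> differentiable f z) ->
  (forall z, rnorm z = rho -> rnorm (f z) <= B) ->
  forall z, rnorm z <= rho -> rnorm (f z) <= B.
Proof.
move=> /andP[rho0 rho1] df fB z zr; rewrite leNgt; apply/negP => Bz.
pose K : set (R * R) := [set p | rnorm (pt p.1 p.2) <= rho].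
have Kin p : K p -> differentiable f (pt p.1 p.2).
  by move=> Kp; apply: df; apply: le_lt_trans Kp rho1.
have cmod : continuous (fun p : R * R => rnorm (pt p.1 p.2)).
  by move=> p; apply: (@continuous_modulus (fun z => z)); exact: diff_id.
have closedK : closed K.
  have -> : K = (fun p : R * R => rnorm (pt p.1 p.2)) @^-1` [set x | x <= rho] by [].
  by apply: closed_comp; [move=> p _; exact: cmod|exact: closed_le].
have compK : compact K.
  apply: (@subclosed_compact _ _ (`[- rho, rho]%classic `*` `[- rho, rho]%classic)) => //.
    by apply: compact_setX; exact: segment_compact.
  move=> p Kp; split; rewrite /= in_itv /=; rewrite -ler_norml;
    apply: le_trans Kp; [exact: (ler_re_rnorm (pt p.1 p.2))|exact: (ler_im_rnorm (pt p.1 p.2))].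
have contK (A : set (R * R)) (h : R * R -> R) : A `<=` K ->
    (forall p, K p -> {for p, continuous h}) -> {within A, continuous h}.
  move=> AK ch; rewrite continuous_subspace_in => p; rewrite inE => Ap.
  by apply: continuous_subspaceT_for => //; apply: ch; exact: AK.
have cont_f p : K p -> {for p, continuous (modulus f)}.
  by move=> Kp; apply: continuous_modulus; exact: Kin.
have Kz : K (re z, im z) by rewrite /K /= pt_reim.
have [p0 /set_mem Kp0 maxp0] := compact_EVT_max (ex_intro _ _ Kz) compK
  (contK K _ (@subset_refl _ K) cont_f).
pose M := modulus f p0.
have fM w : rnorm w <= rho -> rnorm (f w) <= M.
  move=> wr; have := maxp0 (re w, im w); rewrite /modulus /= pt_reim; apply.
  by apply: mem_set; rewrite /K /= pt_reim.
have BM : B < M by apply: lt_le_trans Bz (fM _ zr).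
(* the set of maximum points, of which [p1] below is a rightmost one *)
pose S : set (R * R) := [set p | K p /\ M <= modulus f p].
have closedS : closed S.
  move=> p clp; have Kp : K p by apply: closedK; apply: closure_subset clp => q [].
  split=> //; rewrite leNgt; apply/negP => ltM.
  have nb : nbhs p [set q | modulus f q < M] by exact: (cvgr_lt _ (cont_f p Kp)).
  by have [q [[_ Mq] /= qM]] := clp _ nb; move: Mq; rewrite leNgt qM.
have SK : S `<=` K by move=> p [].
have compS : compact S by exact: subclosed_compact closedS compK SK.
have S0 : S p0 by [].
have [p1 /set_mem [Kp1 Mp1] maxp1] := compact_EVT_max (ex_intro _ _ S0) compS
  (contK S fst SK (fun p _ => cvg_fst (T := R) (U := R))).
have p1rho : rnorm (pt p1.1 p1.2) < rho.
  rewrite lt_neqAle Kp1 andbT; apply/eqP => /fB fp1.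
  by have := lt_le_trans BM (le_trans Mp1 fp1); rewrite ltxx.
set a := pt p1.1 p1.2 in p1rho.
pose h := (rho - rnorm a) / 2.
have h0 : 0 < h by rewrite /h; lra.
have sqK w : square a h w -> rnorm w <= rho.
  move=> [w1 w2]; have -> : w = a + (w - a) by rewrite addrC subrK.
  apply: le_trans (rnormD _ _) _; have := rnorm_le_reim (w - a).
  rewrite !reB !imB; move: w1 w2; rewrite /h; lra.
pose side t := modulus f (p1.1 + h, p1.2 + t).
have sideK t : - h <= t <= h -> K (p1.1 + h, p1.2 + t).
  move=> t1; apply: sqK; split; rewrite /re /im /= addrC addKr ler_norml; lra.
have cside : {within `[- h, h], continuous side}.
  rewrite continuous_subspace_in => t; rewrite inE /= in_itv /= => t1.
  apply: continuous_subspaceT_for; first by rewrite /= in_itv.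
  apply: (@continuous_comp _ _ _ (fun t => (p1.1 + h, p1.2 + t)) (modulus f)).
    have c1 : p1.1 + h @[u --> t] --> p1.1 + h by exact: cvg_cst.
    have c2 : p1.2 + u @[u --> t] --> p1.2 + t by apply: cvgD; [exact: cvg_cst|exact: cvg_id].
    exact: (cvg_pair c1 c2).
  by apply: cont_f; exact: sideK.
have hh : - h <= h by lra.
have [t0 t0in maxt0] := EVT_max hh cside.
move: t0in; rewrite in_itv /= => t0in.
have lt0 : side t0 < M.
  rewrite ltNge; apply/negP => Ms.
  have := maxp1 (p1.1 + h, p1.2 + t0); rewrite /= gerDl leNgt h0 => H.
  have /H // : (p1.1 + h, p1.2 + t0) \in S.
  by apply: mem_set; split; first exact: sideK.
have M0 : 0 < M by apply: le_lt_trans BM; apply: le_trans (rnorm_ge0 _) (fB (rc rho) _);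
  rewrite rnorm_real gtr0_norm.
have : rnorm (f a) ^+ 4 <= side t0 * M ^+ 3.
  apply: (@rnorm_center_side f a h M (side t0) h0).
  - by move=> w /sqK wr; apply: df; exact: le_lt_trans rho1.
  - by move=> w /sqK; exact: fM.
  - move=> t t1; have := maxt0 t; rewrite in_itv /= => /(_ t1).
  by rewrite /side /modulus.
have -> : rnorm (f a) = M by apply/eqP; rewrite eq_le Mp1 andbT; exact: fM (ltW _).
rewrite exprS; apply/negP; rewrite -ltNge ltr_pM2r // exprn_gt0 //.
Qed.

End MaximumPrinciple.

(** * The Schwarz lemma and its consequences *)

Section Schwarz.
Variable R : realType.
Local Notation C := (Cplx R).
Implicit Types (f g : C -> C) (a b c z w : C) (r x y : R).

Lemma diff_schwarz_power f (q : nat) (z : C) : differentiable f z -> f 0 = 0 ->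
  differentiable (fun z => z * (f z / z) ^+ q) z.
Proof.
have [->|z0] := eqVneq z 0; last first.
  move=> df _; apply: diff_mul; first exact: diff_id.
  by apply: diff_exp; apply: diff_div; [exact: df|exact: diff_id|exact: z0].
move=> /cdiffP[D hD] f0; apply/cdiffP; exists (D ^+ q) => e e0.
have dq : differentiable (fun w : C => w ^+ q) D.
  by apply: diff_exp; exact: diff_id.
have [d d0 hd] := differentiable_rnorm_continuous dq e0.
have d2 : 0 < d / 2 by lra.
have [r r0 hr] := hD _ d2; exists r => // w wr.
rewrite mul0r !subr0; have [->|w0] := eqVneq w 0.
  by rewrite mul0r mulr0 subrr rnorm0 mulr0.
rewrite (mulrC (D ^+ q)) -mulrBr rnormM mulrC; apply: ler_wpM2r; first exact: rnorm_ge0.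
apply: ltW; apply: hd.
have -> : f w / w - D = (f w - D * w) / w by field.
rewrite rnorm_div ltr_pdivrMr ?rnorm_gt0 //.
have := hr w wr; rewrite f0 !subr0 => /le_lt_trans; apply.
by have := rnorm_gt0 w0; nra.
Qed.

(** The usual division by [z] would call for a removable singularity;
    [z * (f z / z) ^+ q] is differentiable at once, and the extra factor [z] is
    harmless for large [q]. *)
Lemma schwarz f : (forall z, rnorm z < 1 -> differentiable f z) ->
  (forall z, rnorm z < 1 -> rnorm (f z) <= 1) -> f 0 = 0 ->
  forall z, rnorm z < 1 -> rnorm (f z) <= rnorm z.
Proof.
move=> df fB f0 z z1; have [->|z0] := eqVneq z 0; first by rewrite f0.
have zp := rnorm_gt0 z0.
have bound rho : rnorm z <= rho -> rho < 1 -> rnorm (f z) * rho <= rnorm z.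
  move=> zr r1; have r0 : 0 < rho by apply: lt_le_trans zr.
  suff h : rnorm (f z / z) <= rho^-1.
    by move: h; rewrite rnorm_div ler_pdivrMr // mulrC ler_pdivlMr.
  apply: (@le_of_powers _ _ _ (rho / rnorm z)); [exact: rnorm_ge0| |].
    by rewrite invr_ge0 ltW.
  move=> q; rewrite mulrAC ler_pdivlMr // mulrC -rnormX -rnormM.
  apply: (@maximum_principle _ (fun z => z * (f z / z) ^+ q) rho _ _ _ _ z zr).
  - by rewrite r0 r1.
  - by move=> w w1; apply: diff_schwarz_power; [exact: df|exact: f0].
  - move=> w wr; rewrite rnormM rnormX rnorm_div wr; apply: ler_wpM2l; first exact: ltW.
    rewrite lerXn2r ?nnegrE ?invr_ge0 ?(ltW r0) ?divr_ge0 ?rnorm_ge0 //.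
      by rewrite ltW.
    rewrite -[leRHS]mul1r ler_pM2r ?invr_gt0 //; apply: fB.
    by rewrite wr.
rewrite leNgt; apply/negP => lt.
have f0' : 0 < rnorm (f z) by apply: lt_trans lt.
have f1 := fB z z1.
(* any radius strictly between [rnorm z / rnorm (f z)] and [1] contradicts [bound] *)
pose rho := (1 + rnorm z / rnorm (f z)) / 2.
have q1 : rnorm z / rnorm (f z) < 1 by rewrite ltr_pdivrMr ?mul1r.
have q2 : rnorm z <= rnorm z / rnorm (f z).
  by rewrite ler_pdivlMr // -[leRHS]mulr1 ler_pM2l.
have := bound rho; rewrite /rho => /(_ _ _); set y := rnorm z / rnorm (f z) in q1 q2 *.
have E : y * rnorm (f z) = rnorm z by rewrite /y divfK ?gt_eqF.
move=> H; have {H} : rnorm (f z) * ((1 + y) / 2) <= rnorm z by apply: H; lra.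
by rewrite -E; nra.
Qed.

(** Disk automorphisms, and their compositions with contractions of the disk. *)
Definition mobius a c z : C := (c * z + a) / (1 + cnj a * (c * z)).

Lemma mobius_identity a w :
  rnorm (1 + cnj a * w) ^+ 2 - rnorm (w + a) ^+ 2 =
  (1 - rnorm a ^+ 2) * (1 - rnorm w ^+ 2).
Proof. by rewrite !rnorm_sqr !reimE; ring. Qed.

Lemma rnorm_cnj a : rnorm (cnj a) = rnorm a.
Proof.
by apply/eqP; rewrite -(eqrXn2 (n := 2)) ?rnorm_ge0 // !rnorm_sqr !reimE sqrrN.
Qed.

Lemma rnorm_sqr_lt1 z : rnorm z < 1 -> 0 < 1 - rnorm z ^+ 2.
Proof. by move=> z1; rewrite subr_gt0 expr_lt1 ?rnorm_ge0. Qed.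

Lemma mobius_den a w : rnorm a < 1 -> rnorm w < 1 -> 1 + cnj a * w != 0.
Proof.
move=> a1 w1; apply/eqP => E; have := mobius_identity a w; rewrite E rnorm0.
have := mulr_gt0 (rnorm_sqr_lt1 a1) (rnorm_sqr_lt1 w1).
by have := sqr_ge0 (rnorm (w + a)); lra.
Qed.

Lemma contraction_lt1 c z : rnorm c <= 1 -> rnorm z < 1 -> rnorm (c * z) < 1.
Proof.
move=> c1 z1; rewrite rnormM; apply: le_lt_trans z1.
by rewrite -[leRHS]mul1r ler_wpM2r ?rnorm_ge0.
Qed.

Section MobiusMap.
Variables a c : C.
Hypotheses (a1 : rnorm a < 1) (c1 : rnorm c <= 1).

Lemma mobius_sqr z : rnorm z < 1 ->
  1 - rnorm (mobius a c z) ^+ 2 =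
  (1 - rnorm a ^+ 2) * (1 - rnorm (c * z) ^+ 2) / rnorm (1 + cnj a * (c * z)) ^+ 2.
Proof.
move=> z1; rewrite -mobius_identity /mobius rnorm_div expr_div_n.
have d0 : 0 < rnorm (1 + cnj a * (c * z)).
  by apply: rnorm_gt0; apply: mobius_den a1 _; exact: contraction_lt1.
by rewrite mulrBl divff // expf_neq0 // gt_eqF.
Qed.

Lemma mobius_lt1 z : rnorm z < 1 -> rnorm (mobius a c z) < 1.
Proof.
move=> z1; rewrite -(@expr_lt1 _ 2) ?rnorm_ge0 // -subr_gt0 mobius_sqr //.
have cz := contraction_lt1 c1 z1.
rewrite divr_gt0 ?mulr_gt0 ?rnorm_sqr_lt1 ?exprn_gt0 ?rnorm_gt0 ?mobius_den //.
Qed.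

Lemma diff_mobius z : rnorm z < 1 -> differentiable (mobius a c) z.
Proof.
move=> z1.
have dz : differentiable (fun z : C => c * z) z.
  by apply: diff_mul; [exact: diff_const|exact: diff_id].
apply: diff_div; last by apply: mobius_den => //; exact: contraction_lt1.
  by apply: diff_add; [exact: dz|exact: diff_const].
apply: diff_add; first exact: diff_const.
by apply: diff_mul; [exact: diff_const|exact: dz].
Qed.

Lemma mobius0 : mobius a c 0 = a.
Proof. by rewrite /mobius !mulr0 add0r addr0 divr1. Qed.

End MobiusMap.

Lemma mobiusNK a z : rnorm a < 1 -> rnorm z < 1 ->
  mobius a 1 (mobius (- a) 1 z) = z.
Proof.
move=> a1 z1; have na1 : rnorm (- a) < 1 by rewrite rnormN.
have d1 := mobius_den na1 z1.
have m1 : rnorm (mobius (- a) 1 z) < 1 by apply: mobius_lt1 => //; rewrite rnorm1.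
have d2 := mobius_den a1 m1.
have cN : cnj (- a) = - cnj a by apply: eq_reim; rewrite !reimE.
move: d1 d2; rewrite /mobius !mul1r cN; set A := cnj a => d1 d2; field.
by rewrite d1 /=; apply: contra_neq d2 => E; rewrite -[X in X + _](divff d1) mulrA -mulrDl E mul0r.
Qed.

(** Schwarz-Pick, in a form free of divisions. *)
Lemma schwarz_pick f a z : (forall z, rnorm z < 1 -> differentiable f z) ->
  (forall z, rnorm z < 1 -> rnorm (f z) < 1) -> rnorm a < 1 -> rnorm z < 1 ->
  (1 - rnorm a ^+ 2) * (1 - rnorm z ^+ 2) * rnorm (1 - cnj (f a) * f z) ^+ 2 <=
  (1 - rnorm (f a) ^+ 2) * (1 - rnorm (f z) ^+ 2) * rnorm (1 - cnj a * z) ^+ 2.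
Proof.
move=> df f1 a1 z1.
have n1 : rnorm (1 : C) <= 1 by rewrite rnorm1.
have na1 : rnorm (- a) < 1 by rewrite rnormN.
have nb1 : rnorm (- f a) < 1 by rewrite rnormN f1.
pose u w := mobius (- f a) 1 (f (mobius a 1 w)).
have u1 w : rnorm w < 1 -> rnorm (u w) < 1.
  by move=> w1; apply: mobius_lt1 => //; apply: f1; exact: mobius_lt1.
have du w : rnorm w < 1 -> differentiable u w.
  move=> w1; have dm := diff_mobius a1 n1 w1; have m1 := mobius_lt1 a1 n1 w1.
  have dfm := differentiable_comp dm (df _ m1).
  exact: (differentiable_comp dfm (diff_mobius nb1 n1 (f1 _ m1))).
have u0 : u 0 = 0 by rewrite /u mobius0 /mobius mul1r subrr mul0r.
have m1 := mobius_lt1 na1 n1 z1.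
have := schwarz du (fun w h => ltW (u1 w h)) u0 m1.
rewrite /u mobiusNK // => le.
have : rnorm (mobius (- f a) 1 (f z)) ^+ 2 <= rnorm (mobius (- a) 1 z) ^+ 2.
  by rewrite lerXn2r ?nnegrE ?rnorm_ge0.
rewrite -subr_ge0.
have -> (p q : R) : q - p = (1 - p) - (1 - q) by ring.
rewrite subr_ge0 !mobius_sqr ?f1 // !mul1r.
have -> : cnj (- a) = - cnj a by apply: eq_reim; rewrite !reimE.
have -> : cnj (- f a) = - cnj (f a) by apply: eq_reim; rewrite !reimE.
rewrite !mulNr !rnormN.
have p1 : 0 < rnorm (1 - cnj a * z) ^+ 2.
  rewrite exprn_gt0 ?rnorm_gt0 //; have := mobius_den na1 z1.
  by rewrite (_ : cnj (- a) = - cnj a) ?mulNr //; apply: eq_reim; rewrite !reimE.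
have p2 : 0 < rnorm (1 - cnj (f a) * f z) ^+ 2.
  rewrite exprn_gt0 ?rnorm_gt0 //; have := mobius_den nb1 (f1 _ z1).
  by rewrite (_ : cnj (- f a) = - cnj (f a)) ?mulNr //; apply: eq_reim; rewrite !reimE.
by rewrite ler_pdivrMr // mulrAC ler_pdivlMr // mulrC.
Qed.

(** The Schwarz lemma applied to [(g - g 0) / (g + cnj (g 0))]. *)
Lemma harnack_disk_pos g : (forall z, rnorm z < 1 -> differentiable g z) ->
  (forall z, rnorm z < 1 -> 0 <= re (g z)) -> 0 < re (g 0) ->
  forall z, rnorm z < 1 -> rnorm (g z - g 0) * (1 - rnorm z) <= 2 * re (g 0).
Proof.
move=> dg g_ge g0 z z1.
have den w : rnorm w < 1 -> g w + cnj (g 0) != 0.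
  move=> w1; apply: contraTneq (lt_le_trans g0 _) => // E.
  have := g_ge w w1; have : re (g w) + re (g 0) = 0 by rewrite -(re_cnj (g 0)) -reD E.
  by lra.
pose u w := (g w - g 0) / (g w + cnj (g 0)).
have zero1 : rnorm (0 : C) < 1 by rewrite rnorm0.
have du w : rnorm w < 1 -> differentiable u w.
  move=> w1; apply: diff_div; last exact: den.
    by apply: diff_sub; [exact: dg|exact: diff_const].
  by apply: diff_add; [exact: dg|exact: diff_const].
have u1 w : rnorm w < 1 -> rnorm (u w) <= 1.
  move=> w1; rewrite /u rnorm_div ler_pdivrMr ?rnorm_gt0 ?den // mul1r.
  rewrite -(ler_pXn2r (n := 2)) ?nnegrE ?rnorm_ge0 // !rnorm_sqr !reimE.
  by have := mulr_ge0 (g_ge w w1) (ltW g0); nra.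
have u0 : u 0 = 0 by rewrite /u subrr mul0r.
have := schwarz du u1 u0 z1; rewrite /u rnorm_div ler_pdivrMr ?rnorm_gt0 ?den // => le.
have tri : rnorm (g z + cnj (g 0)) <= rnorm (g z - g 0) + 2 * re (g 0).
  have -> : g z + cnj (g 0) = (g z - g 0) + rc (2 * re (g 0)).
    by apply: eq_reim; rewrite !reimE; ring.
  by apply: le_trans (rnormD _ _) _; rewrite rnorm_real ger0_norm //; lra.
have z0 := rnorm_ge0 z; have := ler_wpM2l z0 tri.
have : rnorm z * (2 * re (g 0)) <= 1 * (2 * re (g 0)) by apply: ler_wpM2r; lra.
lra.
Qed.

(** Adding a small positive constant to [g] reduces to a positive real part. *)
Lemma harnack_disk g : (forall z, rnorm z < 1 -> differentiable g z) ->
  (forall z, rnorm z < 1 -> 0 <= re (g z)) ->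
  forall z, rnorm z < 1 -> rnorm (g z - g 0) * (1 - rnorm z) <= 2 * re (g 0).
Proof.
move=> dg g_ge z z1; apply/ler_addgt0Pl => e e0.
have zero1 : rnorm (0 : C) < 1 by rewrite rnorm0.
pose h w := g w + rc (e / 2).
have E : g z - g 0 = h z - h 0 by rewrite /h; ring.
have -> : e + 2 * re (g 0) = 2 * re (h 0) by rewrite /h reD re_rc; field.
rewrite E; apply: (harnack_disk_pos _ _ _ z1).
- by move=> w w1; apply: diff_add; [exact: dg|exact: diff_const].
- by move=> w w1; rewrite /h reD re_rc; have := g_ge w w1; lra.
- by rewrite /h reD re_rc; have := g_ge 0 zero1; lra.
Qed.

(** Harnack's inequality on the bidisk: two points lie on a common analytic
    disk, whose size is that of the worse coordinate. *)
Lemma harnack_bidisk (p : C * C -> C) (l m : C * C) (k : R) :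
  (forall v, bidisk v -> differentiable p v) ->
  (forall v, bidisk v -> 0 <= re (p v)) -> bidisk l -> bidisk m ->
  rnorm (1 - cnj m.1 * l.1) ^+ 2 <= k * ((1 - rnorm m.1 ^+ 2) * (1 - rnorm l.1 ^+ 2)) ->
  rnorm (1 - cnj m.2 * l.2) ^+ 2 <= k * ((1 - rnorm m.2 ^+ 2) * (1 - rnorm l.2 ^+ 2)) ->
  rnorm (p l - p m) <= 4 * k * re (p m).
Proof.
move=> dp p_ge Dl Dm k1 k2.
have [l1 l2] := (bidiskP l).1 Dl; have [m1 m2] := (bidiskP m).1 Dm.
have n1 : rnorm (1 : C) <= 1 by rewrite rnorm1.
pose dist (a z : C) := mobius (- a) 1 z.
have distP a z : rnorm a < 1 -> rnorm z < 1 ->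
    rnorm (1 - cnj a * z) ^+ 2 <= k * ((1 - rnorm a ^+ 2) * (1 - rnorm z ^+ 2)) ->
    0 < k /\ 1 <= k * (1 - rnorm (dist a z) ^+ 2).
  move=> a1 z1 ak; have na1 : rnorm (- a) < 1 by rewrite rnormN.
  have cN : cnj (- a) = - cnj a by apply: eq_reim; rewrite !reimE.
  have p1 : 0 < rnorm (1 - cnj a * z) ^+ 2.
    by rewrite exprn_gt0 ?rnorm_gt0 //; have := mobius_den na1 z1; rewrite cN mulNr.
  have p2 := mulr_gt0 (rnorm_sqr_lt1 a1) (rnorm_sqr_lt1 z1).
  split; first by rewrite -(pmulr_lgt0 _ p2); exact: lt_le_trans ak.
  by rewrite mobius_sqr // !mul1r cN mulNr rnormN mulrA ler_pdivlMr // mul1r.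
have [k0 d1] := distP _ _ m1 l1 k1; have [_ d2] := distP _ _ m2 l2 k2.
have e1 : rnorm (dist m.1 l.1) < 1 by apply: mobius_lt1; rewrite ?rnormN.
have e2 : rnorm (dist m.2 l.2) < 1 by apply: mobius_lt1; rewrite ?rnormN.
pose rho := Num.max (rnorm (dist m.1 l.1)) (rnorm (dist m.2 l.2)).
have rho0 : 0 <= rho by rewrite le_max rnorm_ge0.
have rho1 : rho < 1 by rewrite gt_max e1 e2.
have dk : 1 <= k * (1 - rho ^+ 2) by rewrite /rho; case: (leP (rnorm (dist m.1 l.1))).
pose dir (a z : C) : C := dist a z / rc rho.
have dirP a z : rnorm (dist a z) <= rho -> rnorm (dir a z) <= 1 /\ dir a z * rc rho = dist a z.
  move=> ar; rewrite /dir rnorm_div rnorm_real ger0_norm //.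
  have [r0|r0] := eqVneq rho 0.
    have : dist a z = 0 by apply: rnorm_eq0; apply/eqP; rewrite eq_le rnorm_ge0 -r0 ar.
    by move=> ->; rewrite r0 rnorm0 !mul0r.
  have rp : 0 < rho by rewrite lt0r r0.
  rewrite ler_pdivrMr // mul1r; split=> //; rewrite divfK //.
  by apply: contra_neq r0 => /(congr1 (@re R)).
have [c1 E1] := dirP m.1 l.1 (ltac:(by rewrite le_max lexx)).
have [c2 E2] := dirP m.2 l.2 (ltac:(by rewrite le_max lexx orbT)).
pose D (z : C) : C * C := (mobius m.1 (dir m.1 l.1) z, mobius m.2 (dir m.2 l.2) z).
have DD z : rnorm z < 1 -> bidisk (D z).
  by move=> z1; apply/bidiskP; split; exact: mobius_lt1.
have dD z : rnorm z < 1 -> differentiable D z.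
  by move=> z1; apply: differentiable_pair; exact: diff_mobius.
have dg z : rnorm z < 1 -> differentiable (p \o D) z.
  by move=> z1; exact: (differentiable_comp (dD _ z1) (dp _ (DD _ z1))).
have rr : rnorm (rc rho) = rho by rewrite rnorm_real ger0_norm.
have rr1 : rnorm (rc rho) < 1 by rewrite rr.
have D0 : D 0 = m by rewrite /D !mobius0; case: (m).
have Dr : D (rc rho) = l.
  have H a z : rnorm a < 1 -> rnorm z < 1 -> dir a z * rc rho = dist a z ->
      mobius a (dir a z) (rc rho) = z.
    move=> a1 z1 E; have := mobiusNK a1 z1.
    by rewrite -/(dist a z) /mobius E mul1r.
  by rewrite /D !H //; case: (l).
have := harnack_disk dg (fun z h => p_ge _ (DD z h)) rr1.
rewrite /= D0 Dr rr; set A := rnorm (p l - p m); set B := re (p m) => H.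
have A0 : 0 <= A := rnorm_ge0 _.
have B0 : 0 <= B := p_ge m Dm.
have s1 : A * (1 - rho) * (1 + rho) * k <= 2 * B * (1 + rho) * k.
  by rewrite !ler_wpM2r ?(ltW k0) //; lra.
have s2 : A * 1 <= A * (k * (1 - rho ^+ 2)) by apply: ler_wpM2l.
have s3 : B * k * rho <= B * k * 1 by apply: ler_wpM2l; [rewrite mulr_ge0 // ltW|exact: ltW].
lra.
Qed.

End Schwarz.

(** * Uniform Taylor estimates and limits of holomorphic functions *)

Section SecondOrder.
Variable R : realType.
Local Notation C := (Cplx R).
Implicit Types (u f : C -> C) (a z w : C) (r t : R).

Lemma diff_fst (v : C * C) : differentiable (fun v : C * C => v.1) v.
Proof.
apply: (linear_differentiable (f := (fst : {linear (C * C)%type -> C}))).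
by move=> w; exact: cvg_fst.
Qed.

Lemma diff_snd (v : C * C) : differentiable (fun v : C * C => v.2) v.
Proof.
apply: (linear_differentiable (f := (snd : {linear (C * C)%type -> C}))).
by move=> w; exact: cvg_snd.
Qed.

Let half_square z : square 0 (1 / 2) z -> rnorm z < 1.
Proof.
rewrite /square /= !subr0 => -[h1 h2].
rewrite -(@expr_lt1 _ 2) ?rnorm_ge0 // rnorm_sqr.
rewrite -(real_normK (num_real (re z))) -(real_normK (num_real (im z))).
have := normr_ge0 (re z); have := normr_ge0 (im z); nra.
Qed.

Let boundary r f := (forall s t, - r <= s <= r -> - r <= t <= r ->
  [\/ s = - r, s = r, t = - r | t = r] -> differentiable f (pt s t)).

Let boundary_cont r f : boundary r f ->
  cont_boundary (re (0 : C) - r) (re (0 : C) + r) (im (0 : C) - r) (im (0 : C) + r) f.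
Proof.
move=> df s t; rewrite re0 im0 !add0r => s1 t1 st.
by apply/cdiff_cont/cdiffP; exact: df.
Qed.

(** Expanding the kernel [1 / (z - a)] to second order in Cauchy's formula
    leaves a remainder of size [rnorm a ^+ 2]; the two leading terms vanish,
    because [u] does to first order. *)
Lemma schwarz_second_order u (M : R) :
  (forall z, rnorm z < 1 -> differentiable u z) ->
  (forall z, rnorm z < 1 -> rnorm (u z) <= M) ->
  (forall e : R, 0 < e -> exists2 d : R, 0 < d &
     forall z, rnorm z < d -> rnorm (u z) <= e * rnorm z) ->
  forall a, rnorm a <= 1 / 4 -> rnorm (u a) <= 32 * M * rnorm a ^+ 2.
Proof.
move=> du uM uo.
have u0 : u 0 = 0.
  have [d d0 hd] := uo 1 ltr01; apply: rnorm_eq0; apply/eqP.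
  rewrite eq_le rnorm_ge0 andbT; have := hd 0; rewrite rnorm0 mulr0; exact.
have h0 : 0 < 1 / 2 :> R by lra.
have q0 : 0 < 1 / 4 :> R by lra.
have z1 : `|re (0 : C) - re (0 : C)| <= 1 / 2 - 1 / 2 by rewrite !subrr normr0.
have z2 : `|im (0 : C) - im (0 : C)| <= 1 / 2 - 1 / 2 by rewrite !subrr normr0.
have dsq z : square 0 (1 / 2) z -> differentiable u z by move=> /half_square; exact: du.
have sqb s t : - (1 / 2) <= s <= 1 / 2 -> - (1 / 2) <= t <= 1 / 2 -> square 0 (1 / 2) (pt s t).
  by move=> s1 t1; apply/square_pt; rewrite re0 im0 !add0r.
have far0 s t : [\/ s = - (1 / 2), s = 1 / 2, t = - (1 / 2) | t = 1 / 2] ->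
    1 / 2 <= rnorm (pt s t : C).
  move=> st; rewrite -[pt s t]subr0; apply: (boundary_far z1 z2).
  by rewrite re0 im0 !add0r.
have ne0 s t : [\/ s = - (1 / 2), s = 1 / 2, t = - (1 / 2) | t = 1 / 2] -> pt s t != 0 :> C.
  by move=> /far0 h; apply/negP => /eqP E; move: h; rewrite E rnorm0; lra.
pose U1 := sint 0 (1 / 2) (fun z => u z / z ^+ 2).
have dU1 : boundary (1 / 2) (fun z => u z / z ^+ 2).
  move=> s t s1 t1 st; apply: diff_div; [exact: dsq (sqb _ _ s1 t1)| |].
    by apply: diff_exp; exact: diff_id.
  by rewrite expf_neq0 // ne0.
have M0 : 0 <= M by apply: le_trans (rnorm_ge0 _) (uM 0 _); rewrite rnorm0.
(* on the boundary the remainder of the kernel is at most [1 / (1/4 * 1/4)] *)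
have main a : rnorm a <= 1 / 4 ->
    rnorm (u a * period 0 (1 / 2) a - a * U1) <= 128 * M * rnorm a ^+ 2.
  move=> a4.
  have a1 : `|re a - re (0 : C)| <= 1 / 2 - 1 / 4.
    by rewrite re0 subr0; apply: le_trans (ler_re_rnorm a) _; lra.
  have a2 : `|im a - im (0 : C)| <= 1 / 2 - 1 / 4.
    by rewrite im0 subr0; apply: le_trans (ler_im_rnorm a) _; lra.
  have fara s t : [\/ s = - (1 / 2), s = 1 / 2, t = - (1 / 2) | t = 1 / 2] ->
      1 / 4 <= rnorm (pt s t - a).
    by move=> st; apply: (boundary_far a1 a2); rewrite re0 im0 !add0r.
  have nea s t : [\/ s = - (1 / 2), s = 1 / 2, t = - (1 / 2) | t = 1 / 2] -> pt s t - a != 0.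
    by move=> /fara h; apply/negP => /eqP E; move: h; rewrite E rnorm0; lra.
  have dza z : differentiable (fun z : C => z - a) z.
    by apply: diff_sub; [exact: diff_id|exact: diff_const].
  have dz0 z : differentiable (fun z : C => z - 0) z.
    by apply: diff_sub; [exact: diff_id|exact: diff_const].
  have d1 : boundary (1 / 2) (fun z => u z / (z - a)).
    move=> s t s1 t1 st; apply: diff_div; [exact: dsq (sqb _ _ s1 t1)|exact: dza|exact: nea].
  have d2 : boundary (1 / 2) (fun z => u z / (z - 0)).
    move=> s t s1 t1 st; apply: diff_div; [exact: dsq (sqb _ _ s1 t1)|exact: dz0|].
    by rewrite subr0; exact: ne0.
  have d3 : boundary (1 / 2) (fun z => a * (u z / z ^+ 2)).
    move=> s t s1 t1 st; apply: diff_mul; first exact: diff_const.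
    exact: (dU1 s t s1 t1 st).
  have d12 : boundary (1 / 2) (fun z => u z / (z - a) - u z / (z - 0)).
    by move=> s t s1 t1 st; apply: diff_sub; [exact: (d1 s t)|exact: (d2 s t)].
  have d4 : boundary (1 / 2) (fun z => u z / (z - a) - u z / (z - 0) - a * (u z / z ^+ 2)).
    by move=> s t s1 t1 st; apply: diff_sub; [exact: (d12 s t)|exact: (d3 s t)].
  have r1 : re (0 : C) - 1 / 2 <= re (0 : C) + 1 / 2 by rewrite re0; lra.
  have r2 : im (0 : C) - 1 / 2 <= im (0 : C) + 1 / 2 by rewrite im0; lra.
  have E : u a * period 0 (1 / 2) a - a * U1 =
      sint 0 (1 / 2) (fun z => u z / (z - a) - u z / (z - 0) - a * (u z / z ^+ 2)).
    rewrite -(cauchy_square q0 a1 a2 dsq) /sint.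
    rewrite (rintB r1 r2 (boundary_cont d12) (boundary_cont d3)).
    rewrite (rintB r1 r2 (boundary_cont d1) (boundary_cont d2)).
    rewrite (rintZ r1 r2 (boundary_cont dU1) a).
    have := cauchy_square h0 z1 z2 dsq; rewrite u0 mul0r /sint => ->.
    by rewrite subr0.
  rewrite E; have -> : 128 * M * rnorm a ^+ 2 = 16 * (16 * M * rnorm a ^+ 2) * (1 / 2) by field.
  apply: sint_bound; [exact: ltW|exact: boundary_cont|].
  move=> s t; rewrite re0 im0 !add0r => s1 t1 st.
  have n0 := ne0 s t st; have na := nea s t st.
  have -> : u (pt s t) / (pt s t - a) - u (pt s t) / (pt s t - 0) - a * (u (pt s t) / pt s t ^+ 2)
     = a ^+ 2 * u (pt s t) / (pt s t ^+ 2 * (pt s t - a)).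
    by field; rewrite na n0.
  rewrite rnorm_div (rnormM (a ^+ 2)) (rnormM (pt s t ^+ 2)) !rnormX.
  have f0 := far0 s t st; have fa := fara s t st.
  have p0 : 0 < rnorm (pt s t) ^+ 2 * rnorm (pt s t - a).
    by rewrite mulr_gt0 ?exprn_gt0 //; lra.
  rewrite ler_pdivrMr //.
  have uz : rnorm (u (pt s t)) <= M by apply: uM; exact: half_square (sqb _ _ s1 t1).
  have n16 : 1 / 16 <= rnorm (pt s t) ^+ 2 * rnorm (pt s t - a).
    have -> : 1 / 16 = (1 / 2) ^+ 2 * (1 / 4) :> R by field.
    by apply: ler_pM; rewrite ?exprn_ge0 // lerXn2r ?nnegrE ?rnorm_ge0.
  have A0 : 0 <= rnorm a ^+ 2 by rewrite exprn_ge0 // rnorm_ge0.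
  have k1 := ler_wpM2l A0 uz.
  have k2 := ler_wpM2l (mulr_ge0 A0 M0) n16.
  lra.
have plow a : rnorm a <= 1 / 4 -> 4 <= rnorm (period 0 (1 / 2) a) <= 32.
  move=> a4.
  have a1 : `|re a - re (0 : C)| <= 1 / 2 - 1 / 4.
    by rewrite re0 subr0; apply: le_trans (ler_re_rnorm a) _; lra.
  have a2 : `|im a - im (0 : C)| <= 1 / 2 - 1 / 4.
    by rewrite im0 subr0; apply: le_trans (ler_im_rnorm a) _; lra.
  rewrite (period_ge q0 a1 a2) /=; apply: period_le => //; lra.
(* [main] and [u a = o(a)], along a real [a = t] that tends to zero *)
have U10 : U1 = 0.
  apply: rnorm_eq0; apply/eqP; rewrite eq_le rnorm_ge0 andbT.
  apply/ler_addgt0Pl => e e0; rewrite addr0.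
  have e64 : 0 < e / 64 by lra.
  have [d d0 hd] := uo _ e64.
  have M1 : 0 < 256 * (M + 1) by lra.
  pose t := Num.min (1 / 4) (Num.min (d / 2) (e / (256 * (M + 1)))).
  have t0 : 0 < t by rewrite !lt_min !divr_gt0.
  have [t1 t2 t3] : [/\ t <= 1 / 4, t <= d / 2 & t <= e / (256 * (M + 1))].
    by rewrite /t; split; rewrite !ge_min lexx ?orbT.
  have nt : rnorm (rc t) = t by rewrite rnorm_real gtr0_norm.
  have tq : rnorm (rc t) <= 1 / 4 by rewrite nt.
  have td : rnorm (rc t) < d by rewrite nt; lra.
  have m1 := main _ tq; have /andP[_ p1] := plow _ tq; have u1 := hd _ td.
  rewrite nt in m1 u1.
  have : t * rnorm U1 <= t * e.
    rewrite -{1}nt -rnormM.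
    have -> : rc t * U1 = u (rc t) * period 0 (1 / 2) (rc t) -
       (u (rc t) * period 0 (1 / 2) (rc t) - rc t * U1) by ring.
    apply: le_trans (rnormB _ _) _; rewrite rnormM.
    have k1 : rnorm (u (rc t)) * rnorm (period 0 (1 / 2) (rc t)) <= e / 64 * t * 32.
      by apply: ler_pM; rewrite ?rnorm_ge0.
    move: t3; rewrite ler_pdivlMr // => t3.
    have k2 := ler_wpM2l (ltW t0) t3.
    have k3 : 0 <= t * t by rewrite mulr_ge0 // ltW.
    have k4 : 128 * M * t ^+ 2 = 128 * M * (t * t) by ring.
    rewrite k4 in m1; lra.
  by rewrite ler_pM2l.
move=> a a4; have := main a a4; rewrite U10 mulr0 subr0 rnormM => m1.
have /andP[p1 _] := plow a a4.
have := ler_wpM2l (rnorm_ge0 (u a)) p1; lra.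
Qed.

(** The Taylor remainder falls under [schwarz_second_order], with a bound that
    does not depend on [f] because the Schwarz lemma bounds [D]. *)
Lemma taylor_disk f (D : C) : (forall z, rnorm z < 1 -> differentiable f z) ->
  (forall z, rnorm z < 1 -> rnorm (f z) <= 1) ->
  (forall e : R, 0 < e -> exists2 d : R, 0 < d &
     forall z, rnorm z < d -> rnorm (f z - f 0 - D * z) <= e * rnorm z) ->
  forall a, rnorm a <= 1 / 4 -> rnorm (f a - f 0 - D * a) <= 128 * rnorm a ^+ 2.
Proof.
move=> df fB hD.
have n2 : rnorm (rc 2 : C) = 2 by rewrite rnorm_real ger0_norm.
have two0 : rc 2 != 0 :> C by apply/eqP => E; move: n2; rewrite E rnorm0; lra.
have zero1 : rnorm (0 : C) < 1 by rewrite rnorm0.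
(* the Schwarz lemma for [(f - f 0) / 2] *)
have D2 : rnorm D <= 2.
  pose g z := (f z - f 0) / rc 2.
  have dg z : rnorm z < 1 -> differentiable g z.
    move=> z1; apply: diff_div; [|exact: diff_const|exact: two0].
    by apply: diff_sub; [exact: df|exact: diff_const].
  have gB z : rnorm z < 1 -> rnorm (g z) <= 1.
    move=> z1; rewrite /g rnorm_div n2 ler_pdivrMr // mul1r.
    by apply: le_trans (rnormB _ _) _; have := fB z z1; have := fB 0 zero1; lra.
  have g0 : g 0 = 0 by rewrite /g subrr mul0r.
  apply/ler_addgt0Pl => e e0; have [d d0 hd] := hD e e0.
  pose t := Num.min (1 / 2) (d / 2).
  have t0 : 0 < t by rewrite lt_min; apply/andP; split; lra.
  have [t1 t2] : t <= 1 / 2 /\ t <= d / 2 by rewrite /t !ge_min !lexx orbT.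
  have nt : rnorm (rc t) = t by rewrite rnorm_real gtr0_norm.
  have tl1 : rnorm (rc t) < 1 by rewrite nt; lra.
  have td : rnorm (rc t) < d by rewrite nt; lra.
  have k1 := schwarz dg gB g0 tl1; have k2 := hd _ td.
  move: k1; rewrite /g rnorm_div n2 ler_pdivrMr // nt => k1.
  rewrite -(ler_pM2r t0) -{1}nt -rnormM.
  have -> : D * rc t = (f (rc t) - f 0) - (f (rc t) - f 0 - D * rc t) by ring.
  by apply: le_trans (rnormB _ _) _; rewrite nt in k2; lra.
move=> a a4; have -> : 128 = 32 * 4 :> R by ring.
apply: (@schwarz_second_order (fun z => f z - f 0 - D * z) 4 _ _ hD _ a4).
  move=> z z1; apply: diff_sub.
    by apply: diff_sub; [exact: df|exact: diff_const].
  by apply: diff_mul; [exact: diff_const|exact: diff_id].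
move=> z z1; apply: le_trans (rnormB _ _) _; rewrite rnormM.
have := rnormB (f z) (f 0); have := fB z z1; have := fB 0 zero1.
have : rnorm D * rnorm z <= 2 * 1.
  by apply: ler_pM; rewrite ?rnorm_ge0 // ltW.
lra.
Qed.

Lemma bidisk_rnorm (v : C * C) : bidisk v <-> rnorm v < 1.
Proof.
rewrite rnorm_pair gt_max; split=> [/bidiskP[-> ->] //|/andP[h1 h2]].
by apply/bidiskP.
Qed.

(** The one-variable estimate on the disk through [x] in the direction of [v],
    whose radius [rho] keeps it inside the bidisk. *)
Lemma taylor_bidisk (f : C * C -> C) (x v : C * C) (rho : R) : 0 < rho ->
  (forall y, bidisk y -> differentiable f y) ->
  (forall y, bidisk y -> rnorm (f y) <= 1) ->
  rnorm x + rho <= 1 -> rnorm v <= rho / 4 ->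
  rnorm (f (x + v) - f x - 'd f x v) <= 128 / rho ^+ 2 * rnorm v ^+ 2.
Proof.
move=> rho0 df fB xr vr.
have rc0 : rc rho != 0.
  apply/eqP => E; have := rnorm_real rho; rewrite E rnorm0 gtr0_norm // => E'.
  by move: rho0; rewrite -E' ltxx.
have [v0|vn] := eqVneq v 0.
  by rewrite v0 addr0 subrr sub0r linear0 rnormN !rnorm0 expr0n mulr0.
have vp := rnorm_gt0 vn.
have nv : rnorm (rc (rnorm v)) = rnorm v by rewrite rnorm_real gtr0_norm.
have rv0 : rc (rnorm v) != 0.
  by apply/eqP => E; move: vp; rewrite -nv E rnorm0 ltxx.
pose w : C * C := (rc rho / rc (rnorm v)) *: v.
have nw : rnorm w = rho.
  by rewrite rnormZ rnorm_div nv rnorm_real gtr0_norm // divfK // gt_eqF.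
have inD z : rnorm z < 1 -> bidisk (x + z *: w).
  move=> z1; have : rnorm (x + z *: w) < 1.
    apply: le_lt_trans (rnormD _ _) _; rewrite rnormZ nw.
    by apply: lt_le_trans xr; rewrite ltrD2l -[ltRHS]mul1r ltr_pM2r.
  by move=> lt1; apply/bidisk_rnorm.
have Dx : bidisk x by have := inD 0; rewrite scale0r addr0; apply; rewrite rnorm0.
have dg z : rnorm z < 1 -> differentiable (fun z => f (x + z *: w)) z.
  move=> z1.
  have da : differentiable (fun z : C => x + z *: w) z.
    apply: (@differentiableD _ _ _ (fun=> x) (fun z : C => z *: w)); first exact: differentiable_cst.
    apply: (@differentiableZl _ _ _ (fun z : C => z) w); exact: diff_id.
  exact: (differentiable_comp da (df _ (inD _ z1))).
pose a := rc (rnorm v) / rc rho.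
have aw : a *: w = v.
  by rewrite /w scalerA /a mulrA divfK // divff // scale1r.
have na : rnorm a = rnorm v / rho by rewrite /a rnorm_div nv rnorm_real gtr0_norm.
have := @taylor_disk (fun z => f (x + z *: w)) ('d f x w) dg.
move=> /(_ (fun z h => fB _ (inD z h)) _ a).
rewrite scale0r addr0 aw na => H.
have -> : 'd f x v = 'd f x w * a.
  by rewrite -{1}aw linearZ /= mulrC.
have -> : 128 / rho ^+ 2 * rnorm v ^+ 2 = 128 * (rnorm v / rho) ^+ 2.
  by rewrite expr_div_n; field; rewrite gt_eqF.
apply: H; last by rewrite ler_pdivrMr // mulrC mul1r.
move=> e e0; have er : 0 < e / rho by rewrite divr_gt0.
have [d d0 hd] := differentiable_has_diff (df _ Dx) er.
exists (d / rho); first by rewrite divr_gt0.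
move=> z; rewrite ltr_pdivlMr // => zd.
have := hd (x + z *: w); rewrite (addrC x) addrK rnormZ nw => /(_ zd).
have -> : 'd f x (z *: w) = 'd f x w * z by rewrite linearZ /= mulrC.
have -> // : e / rho * (rnorm z * rho) = e * rnorm z.
by rewrite mulrC -mulrA (mulrC rho) divfK ?gt_eqF // mulrC.
Qed.

Lemma cauchy_real (c : nat -> R) :
  (forall e : R, 0 < e -> exists N, forall n m, (N <= n)%N -> (N <= m)%N ->
     `|c n - c m| < e) ->
  exists l : R, forall e : R, 0 < e -> exists N, forall n, (N <= n)%N -> `|c n - l| < e.
Proof.
move=> hc; have : cvgn c.
  apply: cauchy_cvg; apply/cauchy_ballP => e e0.
  have [N hN] := hc e e0.
  exists (c @` [set n | (N <= n)%N], c @` [set n | (N <= n)%N]) => /=.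
    by split; exists N => // n nN /=; exists n.
  by move=> [_ _] [[n nN <-] [m mN <-]] /=; rewrite /ball /=; exact: hN.
move=> cl; exists (limn c) => e e0.
have /cvgrPdist_lt/(_ e e0)[N _ hN] := cl; exists N => n /hN.
by rewrite distrC.
Qed.

Lemma cauchy_complex (c : nat -> C) :
  (forall e : R, 0 < e -> exists N, forall n m, (N <= n)%N -> (N <= m)%N ->
     rnorm (c n - c m) < e) ->
  exists l : C, forall e : R, 0 < e -> exists N, forall n, (N <= n)%N -> rnorm (c n - l) < e.
Proof.
move=> hc.
have [|l1 h1] := @cauchy_real (fun n => re (c n)).
  move=> e /hc[N hN]; exists N => n m nN mN; rewrite -reB.
  by apply: le_lt_trans (ler_re_rnorm _) _; exact: hN.
have [|l2 h2] := @cauchy_real (fun n => im (c n)).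
  move=> e /hc[N hN]; exists N => n m nN mN; rewrite -imB.
  by apply: le_lt_trans (ler_im_rnorm _) _; exact: hN.
exists (pt l1 l2) => e e0; have e2 : 0 < e / 2 by lra.
have [N1 k1] := h1 _ e2; have [N2 k2] := h2 _ e2; exists (maxn N1 N2) => n.
rewrite geq_max => /andP[/k1 n1 /k2 n2].
apply: le_lt_trans (rnorm_le_reim _) _; rewrite reB imB /re /im /= -/(re _) -/(im _); lra.
Qed.

(** For a small fixed [t], the slopes differ little from the difference quotients
    at [t], uniformly in [n], and these converge. *)
Lemma slopes_cvg (r K : R) (g : R -> nat -> C) (g0 D : nat -> C) (l : R -> C) (l0 : C) :
  0 < r -> 0 < K ->
  (forall n t, 0 < t -> t <= r -> rnorm (g t n - g0 n - rc t * D n) <= K * t ^+ 2) ->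
  (forall t, 0 < t -> t <= r -> forall e : R, 0 < e ->
     exists N, forall n, (N <= n)%N -> rnorm (g t n - l t) < e) ->
  (forall e : R, 0 < e -> exists N, forall n, (N <= n)%N -> rnorm (g0 n - l0) < e) ->
  exists m : C, forall e : R, 0 < e ->
    exists N, forall n, (N <= n)%N -> rnorm (D n - m) < e.
Proof.
move=> r0 K0 T hg hg0; apply: cauchy_complex => e e0.
have K8 : 0 < 8 * K by lra.
have [t [t0 t1 t2]] : exists t, [/\ 0 < t, t <= r & t <= e / (8 * K)].
  exists (Num.min r (e / (8 * K))); rewrite lt_min !ge_min !lexx orbT; split=> //.
  by rewrite r0 divr_gt0.
have te : 0 < t * e / 16 by rewrite divr_gt0 // mulr_gt0.
have [N1 h1] := hg _ t0 t1 _ te; have [N2 h2] := hg0 _ te.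
exists (maxn N1 N2) => n m; rewrite !geq_max => /andP[n1 n2] /andP[m1 m2].
have kn := T n t t0 t1; have km := T m t t0 t1.
have a1 := h1 _ n1; have a2 := h1 _ m1; have b1 := h2 _ n2; have b2 := h2 _ m2.
move: t2; rewrite ler_pdivlMr // => t2; have k2 := ler_wpM2l (ltW t0) t2.
rewrite -(ltr_pM2l t0) -{1}(gtr0_norm t0) -(rnorm_real t) -rnormM.
have -> : rc t * (D n - D m) =
    ((g t n - l t) - (g t m - l t)) - ((g0 n - l0) - (g0 m - l0))
   + ((g t m - g0 m - rc t * D m) - (g t n - g0 n - rc t * D n)) by ring.
have := rnormD (((g t n - l t) - (g t m - l t)) - ((g0 n - l0) - (g0 m - l0)))
  ((g t m - g0 m - rc t * D m) - (g t n - g0 n - rc t * D n)).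
have := rnormB ((g t n - l t) - (g t m - l t)) ((g0 n - l0) - (g0 m - l0)).
have := rnormB (g t n - l t) (g t m - l t); have := rnormB (g0 n - l0) (g0 m - l0).
have := rnormB (g t m - g0 m - rc t * D m) (g t n - g0 n - rc t * D n).
have tt : K * t ^+ 2 = K * (t * t) by ring.
rewrite tt in kn km; have te0 := mulr_gt0 t0 e0; lra.
Qed.

Lemma linear_pair (L : {linear (C * C)%type -> C}) (v : C * C) :
  L v = L (1, 0) * v.1 + L (0, 1) * v.2.
Proof.
have {1}-> : v = v.1 *: ((1, 0) : C * C) + v.2 *: ((0, 1) : C * C).
  case: v => p q; congr pair.
    by rewrite -[LHS]addr0; congr (_ + _); [exact/esym/mulr1|exact/esym/mulr0].
  by rewrite -[LHS]add0r; congr (_ + _); [exact/esym/mulr0|exact/esym/mulr1].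
rewrite linearD !linearZ; congr (_ + _); exact: mulrC.
Qed.

(** The uniform Taylor estimate makes the derivatives of a pointwise convergent
    sequence a Cauchy sequence, and survives in the limit. *)
Lemma holomorphic_limit (f : nat -> C * C -> C) (h : C * C -> C) :
  (forall n y, bidisk y -> differentiable (f n) y) ->
  (forall n y, bidisk y -> rnorm (f n y) <= 1) ->
  (forall y, bidisk y -> forall e : R, 0 < e ->
     exists N, forall n, (N <= n)%N -> rnorm (f n y - h y) < e) ->
  forall x, bidisk x -> differentiable h x.
Proof.
move=> df fB fh x Dx.
have [rho rhoE] : exists rho, rho = 1 - rnorm x by eexists.
have x1 : rnorm x < 1 by apply/bidisk_rnorm.
have rho0 : 0 < rho by rewrite rhoE; lra.
have xr : rnorm x + rho <= 1 by rewrite rhoE; lra.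
have [K KE] : exists K, K = 128 / rho ^+ 2 by eexists.
have K0 : 0 < K by rewrite KE divr_gt0 // exprn_gt0.
have T n v : rnorm v <= rho / 4 -> rnorm (f n (x + v) - f n x - 'd (f n) x v) <= K * rnorm v ^+ 2.
  by move=> vr; rewrite KE; exact: (taylor_bidisk rho0 (df n) (fB n) xr vr).
have inD v : rnorm v <= rho / 4 -> bidisk (x + v).
  move=> vr; have : rnorm (x + v) < 1 by apply: le_lt_trans (rnormD _ _) _; lra.
  by move=> lt1; apply/bidisk_rnorm.
have lim_dir (w : C * C) : rnorm w = 1 -> exists l : C, forall e : R, 0 < e ->
    exists N, forall n, (N <= n)%N -> rnorm ('d (f n) x w - l) < e.
  move=> w1.
  have r4 : 0 < rho / 4 by rewrite divr_gt0.
  have vr t : 0 < t -> t <= rho / 4 -> rnorm (rc t *: w) <= rho / 4.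
    by move=> t0 tr; rewrite rnormZ w1 mulr1 rnorm_real gtr0_norm.
  apply: (@slopes_cvg _ K (fun t n => f n (x + rc t *: w)) (fun n => f n x)
    (fun n => 'd (f n) x w) (fun t => h (x + rc t *: w)) (h x) r4 K0).
  - move=> n t t0 tr; have := T n _ (vr t t0 tr).
    by rewrite linearZ rnormZ w1 mulr1 rnorm_real gtr0_norm.
  - by move=> t t0 tr; apply: fh; apply: inD; exact: vr.
  - exact: fh.
have n1 : rnorm ((1, 0) : C * C) = 1 by rewrite rnorm_pair /= rnorm1 rnorm0 max_l.
have n2 : rnorm ((0, 1) : C * C) = 1 by rewrite rnorm_pair /= rnorm1 rnorm0 max_r.
have [a ha] := lim_dir _ n1; have [b hb] := lim_dir _ n2.
pose P (v : C * C) : C := a * v.1 + b * v.2.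
have dP v : differentiable P v.
  apply: diff_add; apply: diff_mul; first exact: diff_const.
  - exact: diff_fst.
  - exact: diff_const.
  - exact: diff_snd.
have hP v : rnorm v <= rho / 4 -> rnorm (h (x + v) - h x - P v) <= K * rnorm v ^+ 2.
  move=> vr; apply/ler_addgt0Pl => e e0.
  have v0 := rnorm_ge0 v.
  have e4 : 0 < e / 4 by lra.
  have v1 : rnorm v <= 1 by have := rnorm_ge0 x; lra.
  have [N1 h1] := fh _ (inD _ vr) _ e4; have [N2 h2] := fh _ Dx _ e4.
  have [N3 h3] := ha _ e4; have [N4 h4] := hb _ e4.
  have [n [l1 l2 l3 l4]] : exists n,
      [/\ (N1 <= n)%N, (N2 <= n)%N, (N3 <= n)%N & (N4 <= n)%N].
    exists (maxn (maxn N1 N2) (maxn N3 N4)).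
    by rewrite !leq_max !leqnn !orbT.
  have {}h1 := h1 n l1; have {}h2 := h2 n l2.
  have {}h3 := h3 n l3; have {}h4 := h4 n l4.
  have kn := T n v vr.
  have Ev : 'd (f n) x v = 'd (f n) x (1, 0) * v.1 + 'd (f n) x (0, 1) * v.2.
    exact: linear_pair.
  have c1 : rnorm v.1 <= 1 by apply: le_trans v1; rewrite rnorm_pair le_max lexx.
  have c2 : rnorm v.2 <= 1 by apply: le_trans v1; rewrite rnorm_pair le_max lexx orbT.
  have k3 : rnorm (('d (f n) x (1, 0) - a) * v.1) <= e / 4 * 1.
    by rewrite rnormM; apply: ler_pM; rewrite ?rnorm_ge0 // ltW.
  have k4 : rnorm (('d (f n) x (0, 1) - b) * v.2) <= e / 4 * 1.
    by rewrite rnormM; apply: ler_pM; rewrite ?rnorm_ge0 // ltW.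
  set A := 'd (f n) x (1, 0) in Ev k3; set B := 'd (f n) x (0, 1) in Ev k4.
  have -> : h (x + v) - h x - P v = (f n (x + v) - f n x - 'd (f n) x v) -
     ((f n (x + v) - h (x + v)) - (f n x - h x)) + ((A - a) * v.1 + (B - b) * v.2).
    by rewrite Ev /P; ring.
  have := rnormD ((f n (x + v) - f n x - 'd (f n) x v) -
     ((f n (x + v) - h (x + v)) - (f n x - h x))) ((A - a) * v.1 + (B - b) * v.2).
  have := rnormB (f n (x + v) - f n x - 'd (f n) x v) ((f n (x + v) - h (x + v)) - (f n x - h x)).
  have := rnormB (f n (x + v) - h (x + v)) (f n x - h x).
  have := rnormD ((A - a) * v.1) ((B - b) * v.2).
  lra.
apply: (has_diff_differentiable (L := 'd P x)).
  by apply: diff_continuous; exact: dP.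
move=> e e0; have e2 : 0 < e / 2 by lra.
have [d d0 hd] := differentiable_has_diff (dP x) e2.
exists (Num.min d (Num.min (rho / 4) (e / 2 / K))).
  by rewrite !lt_min d0 !divr_gt0.
move=> y; rewrite !lt_min => /and3P[yd yr yK].
have := hd y yd; have := hP _ (ltW yr); rewrite (addrC x) subrK.
have -> : P y - P x = P (y - x) by rewrite /P /=; ring.
move=> k1 k2.
have -> : h y - h x - 'd P x (y - x) = (h y - h x - P (y - x)) + (P (y - x) - 'd P x (y - x)).
  by rewrite addrA subrK.
apply: le_trans (rnormD _ _) _.
have y0 := rnorm_ge0 (y - x).
move: yK; rewrite ltr_pdivlMr // => yK.
have := ler_wpM2l y0 (ltW yK).
have E : K * rnorm (y - x) ^+ 2 = K * (rnorm (y - x) * rnorm (y - x)) by ring.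
rewrite E in k1; lra.
Qed.

End SecondOrder.

(** * Horodisks and Wolff's lemma *)

Section Horodisks.
Variable R : realType.
Local Notation C := (Cplx R).
Implicit Types (f : C -> C) (a t z w : C).

(** The map of the disk onto the right half-plane that sends [t] to infinity. *)
Definition cayley t z : C := (t + z) / (t - z).

(** The real part of [cayley t z]; its superlevel sets are the horodisks at [t]. *)
Definition horo t z : R := (1 - rnorm z ^+ 2) / rnorm (t - z) ^+ 2.

Section Point.
Variable t : C.
Hypothesis t1 : rnorm t = 1.

Lemma circle_sub_neq0 z : rnorm z < 1 -> t - z != 0.
Proof.
by move=> z1; rewrite subr_eq0; apply: contraTneq z1 => <-; rewrite t1 ltxx.
Qed.

Lemma circle_sub_gt0 z : rnorm z < 1 -> 0 < rnorm (t - z).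
Proof. by move=> z1; apply/rnorm_gt0/circle_sub_neq0. Qed.

Lemma sub_rnorm_le z : 1 - rnorm z <= rnorm (t - z).
Proof. by have := rnormD (t - z) z; rewrite subrK t1; lra. Qed.

Lemma horo_gt0 z : rnorm z < 1 -> 0 < horo t z.
Proof.
by move=> z1; rewrite divr_gt0 ?rnorm_sqr_lt1 // exprn_gt0 // circle_sub_gt0.
Qed.

Lemma re_cayley z : rnorm z < 1 -> re (cayley t z) = horo t z.
Proof.
move=> z1; have d0 := circle_sub_neq0 z1; have dp := circle_sub_gt0 z1.
have t2 : re t ^+ 2 + im t ^+ 2 = 1 by rewrite -rnorm_sqr t1 expr1n.
have E : cayley t z = ((t + z) * cnj (t - z)) * rc (rnorm (t - z) ^- 2).
  have c0 : (t - z) * cnj (t - z) = rc (rnorm (t - z) ^+ 2).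
    by rewrite rnorm_sqr; apply: eq_reim; rewrite !reimE; ring.
  have r0 : rc (rnorm (t - z) ^+ 2) * rc (rnorm (t - z) ^- 2) = 1.
    by apply: eq_reim; rewrite !reimE mulr0 ?subr0 ?mul0r ?addr0 // divff // expf_neq0 // gt_eqF.
  rewrite /cayley; apply: (mulIf d0); rewrite divfK //.
  set q := rc (_ ^- 2) in r0 *; set b := cnj _ in c0 *.
  have -> : (t + z) * b * q * (t - z) = (t + z) * ((t - z) * b * q) by ring.
  by rewrite c0 r0 mulr1.
rewrite E reM re_rc im_rc mulr0 subr0 /horo; congr (_ / _).
by rewrite rnorm_sqr !reimE -t2; ring.
Qed.

(** Large [horo] forces convergence to [t], quantitatively. *)
Lemma sub_le_horo z : rnorm z < 1 -> rnorm (t - z) ^+ 2 * horo t z <= 1.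
Proof.
move=> z1; have dp := circle_sub_gt0 z1.
rewrite /horo mulrC divfK; last by rewrite expf_neq0 // gt_eqF.
by have := sqr_ge0 (rnorm z); lra.
Qed.

(** A point [w] of the horodisk through [z] is at a distance from [t] that is
    quadratic in that of [z], up to the factor that measures how tangentially [z]
    approaches [t]. *)
Lemma sub_le_of_horo z w : rnorm z < 1 -> rnorm w < 1 -> horo t z <= horo t w ->
  rnorm (t - w) * (1 - rnorm z ^+ 2) <= 2 * rnorm (t - z) ^+ 2.
Proof.
move=> z1 w1; have zp := circle_sub_gt0 z1; have wp := circle_sub_gt0 w1.
rewrite /horo ler_pdivrMr ?exprn_gt0 // mulrAC ler_pdivlMr ?exprn_gt0 // => h.
rewrite -(ler_pM2l wp).
have w0 := rnorm_ge0 w; have sub := sub_rnorm_le w.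
have k : 1 - rnorm w ^+ 2 <= 2 * rnorm (t - w).
  have : (1 - rnorm w) * (1 + rnorm w) <= rnorm (t - w) * 2.
    by apply: ler_pM; lra.
  by lra.
have k2 := ler_wpM2r (sqr_ge0 (rnorm (t - z))) k.
lra.
Qed.

End Point.

(** Schwarz-Pick disks centred on the orbit of [0] converge to horodisks at [t],
    so that the Schwarz-Pick inequality becomes the invariance of horodisks in the
    limit, provided one uses the infinitely many times at which the orbit moves
    outwards. *)
Lemma wolff f t : Denjoy_Wolff_point f t ->
  forall z, rnorm z < 1 -> horo t z <= horo t (f z).
Proof.
move=> [[df f_disk] _ /circleP t1 cf] z z1.
have d1 w : rnorm w < 1 -> differentiable f w by move=> /rnorm_lt1P; exact: df.
have f1 w : rnorm w < 1 -> rnorm (f w) < 1.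
  by move=> /rnorm_lt1P/f_disk/rnorm_lt1P.
have zero1 : rnorm (0 : C) < 1 by rewrite rnorm0.
pose a n := iter n f 0.
have a1 n : rnorm (a n) < 1 by elim: n => //= n; exact: f1.
have cvg_a (e : R) : 0 < e -> exists N, forall n, (N <= n)%N -> rnorm (a n - t) < e.
  by move=> e0; exact: (cvg_on_compacts_pointwise cf ((rnorm_lt1P _).2 zero1) e0).
have outward N : exists2 n, (N <= n)%N & rnorm (a n) <= rnorm (a n.+1).
  apply: contrapT => no.
  have dec k : rnorm (a (N + k)%N) <= rnorm (a N).
    elim: k => [|k IH]; first by rewrite addn0.
    rewrite addnS; apply: le_trans IH; rewrite leNgt; apply/negP => lt.
    by apply: no; exists (N + k)%N; [rewrite leq_addr|exact: ltW].
  have aN := a1 N; have e0 : 0 < 1 - rnorm (a N) by lra.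
  have [M hM] := cvg_a _ e0; have := hM (N + M)%N (leq_addl _ _); have := dec M.
  have := sub_rnorm_le t1 (a (N + M)%N); rewrite (rnorm_sub t); lra.
have fz1 := f1 z z1; have zp := circle_sub_gt0 t1 z1; have fzp := circle_sub_gt0 t1 fz1.
have close c w (e : R) : rnorm w < 1 -> rnorm (c - t) <= e ->
    `|rnorm (1 - cnj c * w) - rnorm (t - w)| <= e.
  move=> w1 ce.
  have E : rnorm (t - w) = rnorm (1 - cnj t * w).
    have -> : 1 - cnj t * w = cnj t * (t - w).
      have tt : cnj t * t = 1.
        have := congr1 (fun x => x ^+ 2) t1; rewrite /= rnorm_sqr expr1n => t2.
        by apply: eq_reim; rewrite !reimE; [rewrite -t2|]; ring.
      by rewrite mulrBr tt.
    by rewrite rnormM rnorm_cnj t1 mul1r.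
  have step : rnorm (cnj (c - t) * w) <= e.
    rewrite rnormM rnorm_cnj; apply: le_trans ce.
    by rewrite -[leRHS]mulr1; apply: ler_wpM2l; [exact: rnorm_ge0|exact: ltW].
  have h1 := rnormB (1 - cnj c * w) (- (cnj (c - t) * w)).
  have h2 := rnormB (1 - cnj t * w) (cnj (c - t) * w).
  have E1 : 1 - cnj c * w - - (cnj (c - t) * w) = 1 - cnj t * w.
    by apply: eq_reim; rewrite !reimE; ring.
  have E2 : 1 - cnj t * w - cnj (c - t) * w = 1 - cnj c * w.
    by apply: eq_reim; rewrite !reimE; ring.
  rewrite E1 rnormN in h1; rewrite E2 in h2.
  by rewrite E ler_norml; lra.
rewrite /horo ler_pdivrMr ?exprn_gt0 // mulrAC ler_pdivlMr ?exprn_gt0 //.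
apply/ler_addgt0Pl => q q0.
have [e [e0 e1 eq]] : exists e : R, [/\ 0 < e, e <= 1 & 10 * e <= q].
  exists (Num.min 1 (q / 10)); split; rewrite ?lt_min ?ge_min ?lexx //.
    by rewrite ltr01 divr_gt0.
  by rewrite mulrC -ler_pdivlMr // ge_min lexx orbT.
have [N hN] := cvg_a e e0; have [n Nn out] := outward N.
have h1 := ltW (hN n Nn); have h2 := ltW (hN n.+1 (leqW Nn)).
have SP := schwarz_pick d1 f1 (a1 n) z1.
have cA := close _ _ _ z1 h1; have cB := close _ _ _ fz1 h2.
rewrite -[f (a n)]/(a n.+1) in SP.
move: cA cB SP; rewrite !ler_norml.
have := rnorm_ge0 (1 - cnj (a n) * z); have := rnorm_ge0 (1 - cnj (a n.+1) * f z).
move: (rnorm (1 - cnj (a n) * z)) (rnorm (1 - cnj (a n.+1) * f z)) => A B B0 A0 cA cB SP.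
have T w : rnorm w < 1 -> rnorm (t - w) <= 2.
  by move=> w1; apply: le_trans (rnormB _ _) _; rewrite t1; lra.
have Tz := T z z1; have Tf := T _ fz1.
have sq_le : 1 - rnorm (a n.+1) ^+ 2 <= 1 - rnorm (a n) ^+ 2.
  by rewrite lerD2l lerN2 lerXn2r ?nnegrE ?rnorm_ge0.
have an0 := rnorm_sqr_lt1 (a1 n).
have dw := rnorm_sqr_lt1 fz1; have cz := rnorm_sqr_lt1 z1.
have dw1 : 1 - rnorm (f z) ^+ 2 <= 1 by have := sqr_ge0 (rnorm (f z)); lra.
have cz1 : 1 - rnorm z ^+ 2 <= 1 by have := sqr_ge0 (rnorm z); lra.
move: (rnorm (t - z)) (rnorm (t - f z)) zp fzp Tz Tf cA cB => P Q P0 Q0 P2 Q2 cA cB.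
move: (1 - rnorm z ^+ 2) (1 - rnorm (f z) ^+ 2) dw dw1 cz cz1 SP => c d d0 d_1 c0 c_1 SP.
move: (1 - rnorm (a n) ^+ 2) (1 - rnorm (a n.+1) ^+ 2) sq_le an0 SP => g h hg g0 SP.
have A2 : A ^+ 2 <= P ^+ 2 + 5 * e.
  have : A ^+ 2 <= (P + e) ^+ 2 by rewrite lerXn2r ?nnegrE //; lra.
  have : P * e <= 2 * e by rewrite ler_pM2r.
  have : e * e <= 1 * e by rewrite ler_pM2r.
  by rewrite sqrrD expr2 -mulr_natr; lra.
have B2 : Q ^+ 2 <= B ^+ 2 + 5 * e.
  have : (Q - e) * (Q - e) <= B ^+ 2 \/ Q <= e.
    have [Qe|eQ] := lerP Q e; [by right|left].
    by rewrite expr2; apply: ler_pM; lra.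
  have Qe2 : Q * e <= 2 * e by rewrite ler_pM2r.
  have ee : e * e <= 1 * e by rewrite ler_pM2r.
  have BB := sqr_ge0 B; have ee0 : 0 <= e * e by rewrite mulr_ge0 // ltW.
  case=> [h1'|Qe]; first by rewrite expr2; lra.
  have : Q * Q <= 2 * e by apply: ler_pM => //; exact: ltW.
  by rewrite expr2; lra.
have main : c * B ^+ 2 <= d * A ^+ 2.
  have : g * (c * B ^+ 2) <= g * (d * A ^+ 2).
    rewrite (mulrA g c) (mulrA g d); apply: le_trans SP _; apply: ler_wpM2r; first exact: sqr_ge0.
    by apply: ler_wpM2r => //; exact: ltW.
  by rewrite ler_pM2l.
have k1 := ler_wpM2l (ltW c0) B2; have k2 := ler_wpM2l (ltW d0) A2.
have k3 : c * (5 * e) <= 1 * (5 * e) by apply: ler_wpM2r => //; lra.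
have k4 : d * (5 * e) <= 1 * (5 * e) by apply: ler_wpM2r => //; lra.
lra.
Qed.

End Horodisks.

(** * The angular gradient *)

(** Working with a coordinate [b] treats left and right Type I functions at
    once. *)
Definition crd (R : realType) (b : bool) (l : Cplx R * Cplx R) : Cplx R :=
  if b then l.2 else l.1.

Section AngularGradient.
Variable R : realType.
Local Notation C := (Cplx R).
Implicit Types (l m : C * C).

Lemma rnorm_crd b l : rnorm (crd b l) <= rnorm l.
Proof. by rewrite rnorm_pair le_max; case: b; rewrite lexx ?orbT. Qed.

Lemma crdB b l m : crd b (l - m) = crd b l - crd b m.
Proof. by case: b. Qed.

Lemma diff_crd b l : differentiable (crd b : C * C -> C) l.
Proof. by case: b; [exact: diff_snd|exact: diff_fst]. Qed.

Section Dichotomy.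
Variables (b : bool) (tau : C * C) (phi : C * C -> C).
Hypotheses (tau1 : forall i, rnorm (crd i tau) = 1).
Hypotheses (dphi : forall l, rnorm l < 1 -> differentiable phi l)
  (phi1 : forall l, rnorm l < 1 -> rnorm (phi l) < 1).
Hypothesis julia : forall l, rnorm l < 1 ->
  horo (crd b tau) (crd b l) <= horo (crd b tau) (phi l).

Let t := crd b tau.
Let t1 : rnorm t = 1 := tau1 b.

(** In half-plane coordinates, [phi] moves the coordinate [b] by [drift]. *)
Definition drift l : C := cayley t (phi l) - cayley t (crd b l).

Lemma crd_lt1 i l : rnorm l < 1 -> rnorm (crd i l) < 1.
Proof. by apply: le_lt_trans; exact: rnorm_crd. Qed.

Lemma re_drift l : rnorm l < 1 -> re (drift l) = horo t (phi l) - horo t (crd b l).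
Proof.
by move=> l1; rewrite reB !re_cayley //; [exact: crd_lt1|exact: phi1].
Qed.

Lemma re_drift_ge0 l : rnorm l < 1 -> 0 <= re (drift l).
Proof. by move=> l1; rewrite re_drift // subr_ge0 julia. Qed.

Lemma diff_cayley (f : C * C -> C) l : differentiable f l -> rnorm (f l) < 1 ->
  differentiable (fun l => cayley t (f l)) l.
Proof.
move=> df f1; apply: diff_div; last exact: (circle_sub_neq0 t1 f1).
  by apply: diff_add; [exact: diff_const|exact: df].
by apply: diff_sub; [exact: diff_const|exact: df].
Qed.

Lemma diff_drift l : rnorm l < 1 -> differentiable drift l.
Proof.
move=> l1; apply: diff_sub; apply: diff_cayley.
- exact: dphi.
- exact: phi1.
- exact: diff_crd.
- exact: crd_lt1.
Qed.

(** Undoing the Cayley transforms. *)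
Lemma drift_displacement l : rnorm l < 1 ->
  rnorm (phi l - crd b l) * 2 = rnorm (drift l) * rnorm (t - phi l) * rnorm (t - crd b l).
Proof.
move=> l1; have d1 := circle_sub_neq0 t1 (phi1 l1).
have d2 := circle_sub_neq0 t1 (crd_lt1 b l1).
rewrite -!rnormM.
have -> : drift l * (t - phi l) * (t - crd b l) = (phi l - crd b l) * (rc 2 * t).
  have -> : rc 2 = 1 + 1 :> C by apply: eq_reim; rewrite !reimE; ring.
  by rewrite /drift /cayley; field; rewrite d1 d2.
by rewrite !rnormM t1 mulr1 rnorm_real ger0_norm.
Qed.

Definition min_horo l : R := Num.min (horo (crd false tau) (crd false l))
                                     (horo (crd true tau) (crd true l)).

Lemma min_horo_gt0 l : rnorm l < 1 -> 0 < min_horo l.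
Proof. by move=> l1; rewrite lt_min !horo_gt0 // crd_lt1. Qed.

(** If the drift is not bounded below by a multiple of [min_horo], Harnack's
    inequality based at points where it is small makes it negligible near
    [tau]. *)
Lemma drift_small : (forall c : R, 0 < c -> exists2 m, rnorm m < 1 &
    re (drift m) < c * min_horo m) ->
  forall e : R, 0 < e -> exists2 d : R, 0 < d & forall l, rnorm l < 1 ->
    rnorm (l - tau) < d -> rnorm (drift l) * (1 - rnorm l) <= e.
Proof.
move=> small e e0.
(* Harnack contributes a factor [8], and half of [e] is left to [drift m] *)
have e16 : 0 < e / 16 by lra.
have [m m1 sm] := small _ e16.
have h0 := min_horo_gt0 m1.
have [H HE] : exists H, H = min_horo m by eexists.
rewrite -HE in sm h0.
(* near [tau], the kernels [1 - cnj m * l] are at most twice their limits *)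
have near i : exists2 d : R, 0 < d & forall l, rnorm l < 1 -> rnorm (l - tau) < d ->
    rnorm (1 - cnj (crd i m) * crd i l) ^+ 2 <= 2 * rnorm (crd i tau - crd i m) ^+ 2.
  have mi1 := crd_lt1 i m1; have dp := circle_sub_gt0 (tau1 i) mi1.
  exists (rnorm (crd i tau - crd i m) / 4); first by rewrite divr_gt0.
  move=> l l1 ld; have li := le_lt_trans (rnorm_crd i (l - tau)) ld.
  rewrite crdB in li.
  have tt : cnj (crd i tau) * crd i tau = 1.
    have := congr1 (fun x => x ^+ 2) (tau1 i); rewrite /= rnorm_sqr expr1n => t2.
    by apply: eq_reim; rewrite !reimE; [rewrite -t2|]; ring.
  have E : 1 - cnj (crd i m) * crd i l =
     cnj (crd i tau - crd i m) * crd i tau - cnj (crd i m) * (crd i l - crd i tau).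
    have -> : cnj (crd i tau - crd i m) = cnj (crd i tau) - cnj (crd i m).
      by apply: eq_reim; rewrite !reimE; ring.
    by rewrite mulrBl tt; ring.
  have le : rnorm (1 - cnj (crd i m) * crd i l) <= 5 / 4 * rnorm (crd i tau - crd i m).
    rewrite E; apply: le_trans (rnormB _ _) _; rewrite !rnormM !rnorm_cnj tau1 mulr1.
    have : rnorm (crd i m) * rnorm (crd i l - crd i tau) <=
       1 * (rnorm (crd i tau - crd i m) / 4).
      by apply: ler_pM; rewrite ?rnorm_ge0 // ltW.
    lra.
  have : rnorm (1 - cnj (crd i m) * crd i l) ^+ 2 <= (5 / 4 * rnorm (crd i tau - crd i m)) ^+ 2.
    by rewrite lerXn2r ?nnegrE ?rnorm_ge0 // mulr_ge0 ?rnorm_ge0 //; lra.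
  rewrite exprMn; move/le_trans; apply; apply: ler_wpM2r; first exact: sqr_ge0.
  by rewrite expr2; lra.
have [d1 d10 n1] := near false; have [d2 d20 n2] := near true.
have M0 : 0 <= rnorm (drift m) := rnorm_ge0 _.
have dm0 : 0 < e / 2 / (rnorm (drift m) + 1) by rewrite !divr_gt0 //; lra.
exists (Num.min (Num.min d1 d2) (e / 2 / (rnorm (drift m) + 1))).
  by rewrite !lt_min d10 d20.
move=> l l1; rewrite !lt_min => /andP[/andP[ld1 ld2] ldm].
have L0 : 0 < 1 - rnorm l by lra.
have k i : rnorm (1 - cnj (crd i m) * crd i l) ^+ 2 <= 2 * rnorm (crd i tau - crd i m) ^+ 2 ->
    H <= horo (crd i tau) (crd i m) ->
    rnorm (1 - cnj (crd i m) * crd i l) ^+ 2 <= 2 / H / (1 - rnorm l) *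
     ((1 - rnorm (crd i m) ^+ 2) * (1 - rnorm (crd i l) ^+ 2)).
  move=> K Hi; have mi1 := crd_lt1 i m1; have dp := circle_sub_gt0 (tau1 i) mi1.
  have lc := rnorm_crd i l; have lc0 := rnorm_ge0 (crd i l).
  have ms := rnorm_sqr_lt1 mi1.
  apply: le_trans K _; move: Hi; rewrite /horo ler_pdivlMr ?exprn_gt0 // => Hi.
  have lsq : 1 - rnorm l <= 1 - rnorm (crd i l) ^+ 2.
    have : rnorm (crd i l) * rnorm (crd i l) <= 1 * rnorm l by apply: ler_pM => //; lra.
    by rewrite expr2; lra.
  have -> : 2 / H / (1 - rnorm l) * ((1 - rnorm (crd i m) ^+ 2) * (1 - rnorm (crd i l) ^+ 2)) =
     (2 * ((1 - rnorm (crd i m) ^+ 2) * (1 - rnorm (crd i l) ^+ 2))) / (H * (1 - rnorm l)).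
    by field; rewrite !gt_eqF.
  rewrite ler_pdivlMr ?mulr_gt0 // -mulrA ler_pM2l //.
  rewrite mulrA (mulrC _ H); apply: ler_pM => //; last exact: ltW.
  by rewrite mulr_ge0 ?sqr_ge0 // ltW.
have [Hm1 Hm2] : H <= horo (crd false tau) (crd false m) /\ H <= horo (crd true tau) (crd true m).
  by rewrite HE /min_horo !ge_min !lexx orbT.
have hb := @harnack_bidisk R drift l m (2 / H / (1 - rnorm l))
  (fun v h => diff_drift ((bidisk_rnorm v).1 h)) (fun v h => re_drift_ge0 ((bidisk_rnorm v).1 h))
  ((bidisk_rnorm l).2 l1) ((bidisk_rnorm m).2 m1) (k false (n1 l l1 ld1) Hm1) (k true (n2 l l1 ld2) Hm2).
have tri : rnorm (drift l) <= rnorm (drift m) + rnorm (drift l - drift m).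
  by have := rnormD (drift m) (drift l - drift m); rewrite addrC subrK.
have L1 : 1 - rnorm l <= rnorm (l - tau).
  apply: le_trans (rnorm_crd b _); rewrite crdB rnorm_sub.
  by apply: le_trans (sub_rnorm_le t1 _); rewrite lerD2l lerN2; exact: rnorm_crd.
move: ldm; rewrite ltr_pdivlMr; last by lra.
move=> ldm.
have p1 : (1 - rnorm l) * (rnorm (drift m) + 1) <= rnorm (l - tau) * (rnorm (drift m) + 1).
  by apply: ler_wpM2r => //; lra.
have p2 : rnorm (drift l - drift m) * (1 - rnorm l) <= 8 / H * re (drift m).
  have := ler_wpM2r (ltW L0) hb.
  have -> // : 4 * (2 / H / (1 - rnorm l)) * re (drift m) * (1 - rnorm l) = 8 / H * re (drift m).
  by field; rewrite !gt_eqF.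
have p3 : 8 / H * re (drift m) <= e / 2.
  rewrite mulrAC ler_pdivrMr //; lra.
have := ler_wpM2r (ltW L0) tri; lra.
Qed.

(** In a nontangential region both factors of the drift in
    [drift_displacement] are controlled by the distance to [tau]: the first one
    quadratically, by [sub_le_of_horo]. *)
Lemma displacement_small : (forall c : R, 0 < c -> exists2 m, rnorm m < 1 &
    re (drift m) < c * min_horo m) ->
  forall c e : R, 0 < c -> 0 < e -> exists2 d : R, 0 < d & forall l, rnorm l < 1 ->
    rnorm (tau - l) <= c * (1 - rnorm l) -> rnorm (l - tau) < d ->
    rnorm (phi l - crd b l) <= e * rnorm (l - tau).
Proof.
move=> small c e c0 e0; have ec : 0 < e / c ^+ 2 by rewrite divr_gt0 // exprn_gt0.
have [d d0 hd] := drift_small small ec; exists d => // l l1 nt ld.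
have {}hd := hd l l1 ld; have disp := drift_displacement l1.
have cl1 := crd_lt1 b l1; have pl1 := phi1 l1.
have horo_le := sub_le_of_horo t1 cl1 pl1 (julia l1).
have L0 : 0 < 1 - rnorm l by lra.
have lc := rnorm_crd b l; have lc0 := rnorm_ge0 (crd b l).
have lsq : 1 - rnorm l <= 1 - rnorm (crd b l) ^+ 2.
  have : rnorm (crd b l) * rnorm (crd b l) <= 1 * rnorm l by apply: ler_pM => //; lra.
  by rewrite expr2; lra.
have td : rnorm (t - crd b l) <= rnorm (l - tau).
  by rewrite (rnorm_sub l) -crdB; exact: rnorm_crd.
rewrite (rnorm_sub tau) in nt.
move: (rnorm (l - tau)) (rnorm (t - crd b l)) (rnorm (t - phi l)) (rnorm (drift l))
  (rnorm (phi l - crd b l)) (1 - rnorm (crd b l) ^+ 2) (1 - rnorm l)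
  (rnorm_ge0 (t - crd b l)) (rnorm_ge0 (t - phi l)) (rnorm_ge0 (drift l))
  (rnorm_ge0 (l - tau)) L0 lsq td nt disp horo_le hd.
move=> D q p P X s L q0 p0 P0 D0 L0 lsq td nt disp horo_le hd.
clear - D q p P X s L q0 p0 P0 D0 L0 lsq td nt disp horo_le hd c0 e0.
have pL : p * L <= 2 * (D * D).
  apply: le_trans (le_trans horo_le _); first by apply: ler_wpM2l.
  by rewrite ler_pM2l // expr2; apply: ler_pM.
have h1 : X * 2 * L <= P * (2 * (D * D)) * D.
  rewrite disp; have -> : P * p * q * L = P * (p * L) * q by ring.
  by apply: ler_pM; rewrite ?mulr_ge0 // ?(ltW L0) //; apply: ler_wpM2l.
have h2 : P * (D * D) <= P * ((c * L) * (c * L)) by apply: ler_wpM2l => //; apply: ler_pM.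
move: hd; rewrite ler_pdivlMr ?exprn_gt0 // => hd.
have h3 : P * (D * D) * D <= (e * L) * D.
  apply: ler_wpM2r => //; apply: le_trans h2 _.
  have -> : P * (c * L * (c * L)) = P * L * c ^+ 2 * L by ring.
  by apply: ler_wpM2r; [exact: ltW|].
have : X * L <= e * D * L by lra.
by rewrite ler_pM2r.
Qed.

Lemma approach_radially (d : R) : 0 < d -> exists r : R,
  [/\ 0 < r, r < 1 & rnorm (rc r *: tau) = r /\ rnorm (rc r *: tau - tau) < d].
Proof.
move=> d0; have nt : rnorm tau = 1.
  by rewrite rnorm_pair (tau1 false) (tau1 true) maxxx.
have [q [q0 q1 qd]] : exists q : R, [/\ 0 < q, q < 1 & q < d].
  exists (Num.min (1 / 2) (d / 2)); rewrite !lt_min !gt_min.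
  split; [apply/andP; split|apply/orP; left|apply/orP; right]; lra.
exists (1 - q); split; try lra; split.
  by rewrite rnormZ nt mulr1 rnorm_real ger0_norm //; lra.
have -> : rc (1 - q) *: tau - tau = (- rc q) *: tau.
  rewrite -{2}[tau]scale1r -scalerBl; congr (_ *: _).
  by apply: eq_reim; rewrite !reimE; ring.
by rewrite rnormZ nt mulr1 rnormN rnorm_real ger0_norm // ltW.
Qed.

(** On the radius that ends at [tau], [sub_le_of_horo] bounds the quotient by
    [2]. *)
Lemma B_point_torus : B_point phi tau.
Proof.
split.
  split.
    move=> A /nbhs_rnormP[d d0 dA].
    have [r [r0 r1 [rn rd]]] := approach_radially d0.
    by exists (rc r *: tau); split; [apply/bidisk_rnorm; rewrite rn|exact: dA].
  move=> /nbhs_singleton/bidiskP[h _]; have := tau1 false; rewrite /crd => E.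
  by move: h; rewrite E ltxx.
rewrite limf_einfE; apply: (@le_lt_trans _ _ (2%:E)); last by rewrite ltry.
apply: ge_ereal_sup => _ [A FA <-].
have /nbhs_rnormP[d d0 dA] := FA.
have [r [r0 r1 [rn rd]]] := approach_radially d0.
set l := rc r *: tau in rn rd.
have l1 : rnorm l < 1 by rewrite rn.
have Al : A l by apply: dA => //; exact/bidisk_rnorm.
apply: le_trans (ereal_inf_lbound _) _; first by exists l.
rewrite lee_fin !normE rn.
have -> : complex.Re ((1 - (rnorm (phi l))%:C%C) / (1 - r%:C%C)) = (1 - rnorm (phi l)) / (1 - r).
  by rewrite -(rmorph1 (real_complex R)) -!rmorphB -fmorphV -rmorphM.
rewrite ler_pdivrMr; last by lra.
have := sub_le_of_horo t1 (crd_lt1 b l1) (phi1 l1) (julia l1).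
have -> : crd b l = rc r * t by rewrite /l /t; case: (b).
have -> : t - rc r * t = rc (1 - r) * t.
  by apply: eq_reim; rewrite !reimE; ring.
rewrite !rnormM t1 !mulr1 !rnorm_real !ger0_norm; try lra.
have := sub_rnorm_le t1 (phi l); move: (rnorm (t - phi l)) => p ph.
have -> : 1 - r ^+ 2 = (1 + r) * (1 - r) by ring.
have -> : 2 * (1 - r) ^+ 2 = 2 * (1 - r) * (1 - r) by ring.
rewrite mulrA ler_pM2r; last by lra.
have p0 : 0 <= p by have := phi1 l1; lra.
have : 0 <= p * r by rewrite mulr_ge0 // ltW.
lra.
Qed.

(** The nontangential limit is [t] and the angular gradient is that of the
    coordinate [b], because [phi l - crd b l] is negligible. *)
Lemma C_point_of_small_drift : (forall c : R, 0 < c -> exists2 m, rnorm m < 1 &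
    re (drift m) < c * min_horo m) -> C_point phi tau.
Proof.
move=> small; split; first exact: B_point_torus.
have near_gradient S : approaches_nontangentially S tau -> forall e : R, 0 < e ->
    \forall l \near within S (nbhs tau), rnorm (phi l - crd b l) <= e * rnorm (l - tau).
  move=> [SD _ [c c0 Sc]] e e0.
  have [d d0 hd] := displacement_small small c0 e0.
  apply/nbhs_rnormP; exists d => // l ld Sl; apply: hd => //.
    by apply/bidisk_rnorm; exact: SD.
  have := Sc l Sl; rewrite !normE -[1 : R[i]]/(1%:C%C) -rmorphB -rmorphM lecR.
  exact.
exists t.
  move=> S ntS; apply/cvgrPdist_le => _ /complex_gt0P[e e0 ->].
  have near1 := near_gradient S ntS 1 ltr01.
  have near2 : \forall l \near within S (nbhs tau), rnorm (l - tau) < e / 2.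
    by apply: cvg_within; apply/nbhs_rnormP; exists (e / 2); rewrite ?divr_gt0.
  apply: filterS2 near1 near2 => l h1 h2.
  rewrite normE lecR; have -> : t - phi l = (t - crd b l) - (phi l - crd b l) by ring.
  apply: le_trans (rnormB _ _) _.
  have := rnorm_crd b (l - tau); rewrite crdB rnorm_sub; lra.
pose eta : C * C := if b then (0, 1) else (1, 0); exists eta => S ntS.
have lin l : eta.1 * (l.1 - tau.1) + eta.2 * (l.2 - tau.2) = crd b l - t.
  by rewrite /eta /t; case: (b); rewrite /= !(mul0r, mul1r) ?add0r ?addr0.
apply: eqaddoEx => l; move: l; apply/funeqP; apply/eqaddoP => _ /complex_gt0P[e e0 ->].
apply: filterS (near_gradient S ntS e e0) => l.
rewrite !normE -rmorphM lecR.
have -> : phi l - crd b l = phi l - (t + (crd b l - t)) by ring.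
by rewrite -lin.
Qed.

End Dichotomy.
End AngularGradient.

(** * Cluster points of the iterates *)

Section Iterates.
Variable R : realType.
Local Notation C := (Cplx R).
Variables (F : C * C -> C * C) (tau : C * C).
Hypotheses (tau1 : forall i, rnorm (crd i tau) = 1).
Hypotheses (dF : forall l, rnorm l < 1 -> differentiable F l)
  (F1 : forall l, rnorm l < 1 -> rnorm (F l) < 1).
Hypothesis julia : forall i l, rnorm l < 1 ->
  horo (crd i tau) (crd i l) <= horo (crd i tau) (crd i (F l)).
Implicit Types (l : C * C) (i b : bool).

Lemma iter_lt1 n l : rnorm l < 1 -> rnorm (iter n F l) < 1.
Proof. by move=> l1; elim: n => //= n; exact: F1. Qed.

Lemma diff_iter n l : rnorm l < 1 -> differentiable (iter n F) l.
Proof.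
move=> l1; elim: n => [|n IH]; first by apply: ex_diff; exact: is_diff_id.
exact: (differentiable_comp IH (dF (iter_lt1 n l1))).
Qed.

Lemma diff_crd_iter i n l : rnorm l < 1 -> differentiable (fun l => crd i (iter n F l)) l.
Proof. by move=> l1; exact: (differentiable_comp (diff_iter n l1) (diff_crd i _)). Qed.

Lemma horo_iter i n l : rnorm l < 1 ->
  horo (crd i tau) (crd i l) <= horo (crd i tau) (crd i (iter n F l)).
Proof.
move=> l1; elim: n => [|n IH] //; apply: le_trans IH _.
by apply: julia; exact: iter_lt1.
Qed.

(** Away from C-points the drift is bounded below along orbits, on which
    [min_horo] increases. *)
Lemma iter_escapes b : ~ C_point (fun l => crd b (F l)) tau ->
  forall l, rnorm l < 1 -> forall e : R, 0 < e ->
  exists N, forall n, (N <= n)%N -> rnorm (crd b (iter n F l) - crd b tau) < e.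
Proof.
move=> nC l l1 e e0.
pose phi l := crd b (F l).
have dphi m : rnorm m < 1 -> differentiable phi m.
  by move=> m1; exact: (differentiable_comp (dF m1) (diff_crd b _)).
have phi1 m : rnorm m < 1 -> rnorm (phi m) < 1.
  by move=> m1; exact: crd_lt1 (F1 m1).
have [c c0 hc] : exists2 c : R, 0 < c & forall m, rnorm m < 1 ->
    c * min_horo tau m <= re (drift b tau phi m).
  apply: contrapT => no; apply: nC.
  apply: (C_point_of_small_drift tau1 dphi phi1 (julia b)) => c c0.
  apply: contrapT => no'; apply: no; exists c => // m m1.
  by rewrite leNgt; apply/negP => lt; apply: no'; exists m.
have h0 := min_horo_gt0 tau1 l1.
have step n : c * min_horo tau l <= horo (crd b tau) (crd b (iter n.+1 F l)) -
    horo (crd b tau) (crd b (iter n F l)).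
  have m1 := iter_lt1 n l1.
  apply: le_trans (le_trans _ (hc _ m1)) _; last by rewrite (re_drift b tau1 phi1).
  rewrite ler_pM2l // /min_horo le_min !ge_min.
  by rewrite !horo_iter ?orbT.
have grow n : n%:R * (c * min_horo tau l) <= horo (crd b tau) (crd b (iter n F l)).
  elim: n => [|n IH].
    by rewrite mul0r ltW // horo_gt0 // crd_lt1.
  by have := step n; rewrite -natr1; lra.
have q0 : 0 < c * min_horo tau l by rewrite mulr_gt0.
have [N hN] : exists N : nat, (e ^+ 2 * (c * min_horo tau l))^-1 < N%:R.
  exists (Num.truncn (e ^+ 2 * (c * min_horo tau l))^-1).+1.
  exact: truncnS_gt.
exists N => n Nn; rewrite rnorm_sub ltNge; apply/negP => ge.
have m1 := iter_lt1 n l1.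
have := sub_le_horo (tau1 b) (crd_lt1 b m1); apply/negP; rewrite -ltNge.
have e2 : e ^+ 2 <= rnorm (crd b tau - crd b (iter n F l)) ^+ 2.
  by rewrite lerXn2r ?nnegrE ?rnorm_ge0 // ltW.
have nn : N%:R <= n%:R :> R by rewrite ler_nat.
have E2 : 0 < e ^+ 2 by rewrite exprn_gt0.
have big : 1 < e ^+ 2 * (n%:R * (c * min_horo tau l)).
  rewrite mulrCA -ltr_pdivrMr ?mulr_gt0 // div1r.
  exact: lt_le_trans hN nn.
apply: lt_le_trans big _; apply: ler_pM => //; first exact: ltW.
by rewrite mulr_ge0 ?ler0n // ltW.
Qed.

Section Cluster.
Variables (G : C * C -> C * C) (hG : iterates_cluster_point F G).

Lemma cluster_pointwise : exists2 k : nat -> nat, (forall n, (n <= k n)%N) &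
  forall l, rnorm l < 1 -> forall e : R, 0 < e ->
  exists N, forall n, (N <= n)%N -> rnorm (iter (k n) F l - G l) < e.
Proof.
have [k k_inc cG] := hG; exists k.
  by elim=> [//|n IH]; apply: leq_ltn_trans IH (k_inc _ _ _).
by move=> l /bidisk_rnorm Dl e e0; exact: (cvg_on_compacts_pointwise cG Dl e0).
Qed.

(** If the holomorphic limit attains modulus one, Harnack's inequality makes it
    constant, and the horodisks at [tau], which are invariant, touch the circle at
    [tau] only. *)
Lemma cluster_coordinate i :
  holomorphic_map bidisk disk (fun l => crd i (G l)) \/
  (forall l, bidisk l -> crd i (G l) = crd i tau).
Proof.
have [k k_ge cG] := cluster_pointwise.
pose h l := crd i (G l); pose f n l := crd i (iter (k n) F l).
have f1 n l : rnorm l < 1 -> rnorm (f n l) < 1 by move=> l1; exact: crd_lt1 (iter_lt1 _ l1).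
have cf l : rnorm l < 1 -> forall e : R, 0 < e ->
    exists N, forall n, (N <= n)%N -> rnorm (f n l - h l) < e.
  move=> l1 e e0; have [N hN] := cG l l1 e e0; exists N => n Nn.
  by apply: le_lt_trans (hN n Nn); rewrite /f /h -crdB; exact: rnorm_crd.
have dh l : bidisk l -> differentiable h l.
  apply: (@holomorphic_limit R f h).
  - by move=> n y /bidisk_rnorm; exact: diff_crd_iter.
  - by move=> n y /bidisk_rnorm/(f1 n)/ltW.
  - by move=> y /bidisk_rnorm; exact: cf.
have h_le1 l : rnorm l < 1 -> rnorm (h l) <= 1.
  move=> l1; apply/ler_addgt0Pl => e e0; have [N hN] := cf l l1 e e0.
  have := hN N (leqnn N); rewrite rnorm_sub => lt.
  by have := rnormD (h l - f N l) (f N l); rewrite subrK; have := f1 N l l1; lra.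
have [all1|] := pselect (forall l, rnorm l < 1 -> rnorm (h l) < 1).
  by left; split=> // l /bidisk_rnorm/all1/rnorm_lt1P.
move=> /existsNP[l0 /not_implyP[l01 /negP]]; rewrite -leNgt => h0.
have {}h0 : rnorm (h l0) = 1 by apply/eqP; rewrite eq_le h0 h_le1.
right.
have value : h l0 = crd i tau.
  apply/esym/eqP; rewrite -subr_eq0; apply/eqP; apply: rnorm_eq0.
  apply/eqP; rewrite eq_le rnorm_ge0 andbT.
  have H0 := horo_gt0 (tau1 i) (crd_lt1 i l01).
  have [H HE] : exists H, H = horo (crd i tau) (crd i l0) by eexists.
  rewrite -HE in H0.
  rewrite leNgt; apply/negP => d0.
  have [d dE] : exists d, d = rnorm (crd i tau - h l0) by eexists.
  rewrite -dE in d0.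
  have q0 : 0 < H * d / 8 by rewrite divr_gt0 // mulr_gt0.
  have [e [e0 e1 e2]] : exists e : R, [/\ 0 < e, e <= d / 2 & e <= H * d ^+ 2 / 16].
    exists (Num.min (d / 2) (H * d ^+ 2 / 16)); rewrite lt_min !ge_min !lexx orbT.
    by rewrite !divr_gt0 // mulr_gt0 // exprn_gt0.
  have [N hN] := cf l0 l01 e e0; have {}hN := hN N (leqnn N).
  have fN := f1 N _ l01.
  have hor := horo_iter i (k N) l01; rewrite -HE -/(f N l0) in hor.
  have dp := circle_sub_gt0 (tau1 i) fN.
  move: hor; rewrite /horo ler_pdivlMr ?exprn_gt0 // => hor.
  have t1 := rnormD (crd i tau - f N l0) (f N l0 - h l0).
  have t2 := rnormD (h l0 - f N l0) (f N l0).
  rewrite addrA subrK -dE in t1; rewrite subrK h0 (rnorm_sub (h l0)) in t2.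
  move: (rnorm (f N l0 - h l0)) (rnorm (crd i tau - f N l0)) (rnorm (f N l0))
    (rnorm_ge0 (f N l0)) hN fN dp hor t1 t2 => x y z z0 hN fN dp hor t1 t2.
  clear - d d0 H H0 e e0 e1 e2 x y z z0 hN fN dp hor t1 t2.
  have y2 : d / 2 <= y by lra.
  have yy : (d / 2) * (d / 2) <= y * y by apply: ler_pM => //; lra.
  have k1 := ler_wpM2l (ltW H0) yy.
  have z2 : 1 - z ^+ 2 <= 2 * e.
    have : (1 - z) * (1 + z) <= e * 2 by apply: ler_pM; lra.
    by rewrite expr2; lra.
  have Hd : 0 < H * d ^+ 2 by rewrite mulr_gt0 // exprn_gt0.
  rewrite expr2 in hor; rewrite expr2 in Hd e2; lra.
move=> l /bidisk_rnorm l1; rewrite -value -/(h l).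
pose p l := 1 - cnj (h l0) * h l.
have dp m : bidisk m -> differentiable p m.
  move=> Dm; apply: diff_sub; first exact: diff_const.
  by apply: diff_mul; [exact: diff_const|exact: dh].
have p_ge m : bidisk m -> 0 <= re (p m).
  move=> /bidisk_rnorm m1; rewrite /p reB re1 subr_ge0.
  apply: le_trans (le_trans (ler_norm _) (ler_re_rnorm _)) _.
  by rewrite rnormM rnorm_cnj h0 mul1r h_le1.
have hh : h l0 * cnj (h l0) = 1.
  have := congr1 (fun x => x ^+ 2) h0; rewrite /= rnorm_sqr expr1n => t2.
  by apply: eq_reim; rewrite !reimE; [rewrite -t2|]; ring.
have p0 : p l0 = 0 by rewrite /p mulrC hh subrr.
pose kern j := rnorm (1 - cnj (crd j l0) * crd j l) ^+ 2 /
  ((1 - rnorm (crd j l0) ^+ 2) * (1 - rnorm (crd j l) ^+ 2)).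
have kern_pos j : 0 < (1 - rnorm (crd j l0) ^+ 2) * (1 - rnorm (crd j l) ^+ 2).
  by rewrite mulr_gt0 // rnorm_sqr_lt1 // crd_lt1.
have kernE j : rnorm (1 - cnj (crd j l0) * crd j l) ^+ 2 <= (kern false + kern true) *
    ((1 - rnorm (crd j l0) ^+ 2) * (1 - rnorm (crd j l) ^+ 2)).
  have k0 j' : 0 <= kern j' by rewrite divr_ge0 ?sqr_ge0 // ltW.
  rewrite -ler_pdivrMr // -/(kern j); case: j.
    by rewrite lerDr k0.
  by rewrite lerDl k0.
have := harnack_bidisk dp p_ge ((bidisk_rnorm l).2 l1) ((bidisk_rnorm l0).2 l01)
  (kernE false) (kernE true).
rewrite p0 re0 mulr0 subr0 => pl; have {}pl : p l = 0.
  by apply: rnorm_eq0; apply/eqP; rewrite eq_le pl rnorm_ge0.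
have : h l0 * p l = h l0 - h l by rewrite /p mulrBr mulr1 mulrA hh mul1r.
by rewrite pl mulr0 => /esym/eqP; rewrite subr_eq0 => /eqP.
Qed.

Lemma cluster_escapes b : ~ C_point (fun l => crd b (F l)) tau ->
  forall l, bidisk l -> crd b (G l) = crd b tau.
Proof.
move=> nC l /bidisk_rnorm l1; have [k k_ge cG] := cluster_pointwise.
apply/eqP; rewrite -subr_eq0; apply/eqP; apply: rnorm_eq0; apply/eqP.
rewrite eq_le rnorm_ge0 andbT; apply/ler_addgt0Pl => e e0; rewrite addr0.
have e2 : 0 < e / 2 by rewrite divr_gt0.
have [N1 h1] := cG l l1 _ e2; have [N2 h2] := iter_escapes nC l1 e2.
have {}h1 := h1 _ (leq_maxl N1 N2).
have {}h2 := h2 _ (leq_trans (leq_maxr N1 N2) (k_ge _)).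
have h3 := rnorm_crd b (iter (k (maxn N1 N2)) F l - G l).
rewrite crdB in h3.
have := rnormB (crd b (iter (k (maxn N1 N2)) F l) - crd b tau)
  (crd b (iter (k (maxn N1 N2)) F l) - crd b (G l)).
have -> (x y z : C) : x - y - (x - z) = z - y by ring.
lra.
Qed.

End Cluster.
End Iterates.

Theorem theorem2p13 (R : realType) (phi psi : Cplx R * Cplx R -> Cplx R)
    (tau1 tau2 : Cplx R)
    (F := fun l : Cplx R * Cplx R => (phi l, psi l))
    (hF : holomorphic_map bidisk bidisk F)
    (hphi : left_type_I phi) (hpsi : right_type_I psi)
    (htau1 : forall mu, disk mu -> Denjoy_Wolff_point (fun l => phi (l, mu)) tau1)
    (htau2 : forall l, disk l -> Denjoy_Wolff_point (fun mu => psi (l, mu)) tau2) :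
  (~ C_point phi (tau1, tau2) ->
     forall G : Cplx R * Cplx R -> Cplx R * Cplx R, iterates_cluster_point F G ->
     exists h : Cplx R * Cplx R -> Cplx R,
       (forall l, bidisk l -> G l = (tau1, h l)) /\
       (holomorphic_map bidisk disk h \/ (forall l, bidisk l -> h l = tau2)))
  /\
  (~ C_point psi (tau1, tau2) ->
     forall G : Cplx R * Cplx R -> Cplx R * Cplx R, iterates_cluster_point F G ->
     exists g : Cplx R * Cplx R -> Cplx R,
       (forall l, bidisk l -> G l = (g l, tau2)) /\
       (holomorphic_map bidisk disk g \/ (forall l, bidisk l -> g l = tau1))).
Proof.
have zero1 : disk (0 : Cplx R) by apply/rnorm_lt1P; rewrite rnorm0.
have tau_circle i : rnorm (crd i (tau1, tau2)) = 1.
  by case: i; apply/circleP; [have [] := htau2 0 zero1|have [] := htau1 0 zero1].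
have [dF F_bidisk] := hF.
have dF' l : rnorm l < 1 -> differentiable F l by move=> /bidisk_rnorm; exact: dF.
have F1 l : rnorm l < 1 -> rnorm (F l) < 1 by move=> /bidisk_rnorm/F_bidisk/bidisk_rnorm.
have julia i l : rnorm l < 1 -> horo (crd i (tau1, tau2)) (crd i l) <=
    horo (crd i (tau1, tau2)) (crd i (F l)).
  case: l => x y /bidisk_rnorm/bidiskP[/= x1 y1]; case: i => /=.
    exact: (wolff (htau2 _ ((rnorm_lt1P x).2 x1)) y1).
  exact: (wolff (htau1 _ ((rnorm_lt1P y).2 y1)) x1).
split=> nC G hG.
  exists (fun l => (G l).2); split.
    move=> l Dl; have := cluster_escapes tau_circle dF' F1 julia hG (b := false) nC Dl.
    by rewrite /crd /= => <-; case: (G l).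
  exact: (cluster_coordinate tau_circle dF' F1 julia hG true).
exists (fun l => (G l).1); split.
  move=> l Dl; have := cluster_escapes tau_circle dF' F1 julia hG (b := true) nC Dl.
  by rewrite /crd /= => <-; case: (G l).
exact: (cluster_coordinate tau_circle dF' F1 julia hG false).
Qed.
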